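(* Let $\Lambda=\{\lambda_n\}$ be a sequence contained in the strip $S=\{z\in\mathbb C:\ \alpha\le\operatorname{Im}z\le\beta\}$, $0<\alpha\le\beta<\infty$, which is not relatively uniformly discrete. Then for every $r>0$ there exists a numbering of the points in each of the subsequences $\Lambda^{(p)}(r)$ such that the family $\{\mathcal E^{(p)}(\Lambda,r)\}_p$ (the union over $p$ of the families $\mathcal E^{(p)}(\Lambda,r)$ of generalized divided differences) is not uniformly minimal in $L^2(0,\infty)$. Moreover, for every $\varepsilon>0$ there exists a pair $\varphi_m,\varphi_{m+1}$ of consecutive generalized divided differences corresponding to some $\Lambda^{(p)}(r)$ (i.e. $\varphi_m=[\lambda_{1,p},\dots,\lambda_{m,p}]$, $\varphi_{m+1}=[\lambda_{1,p},\dots,\lambda_{m+1,p}]$) such that $$\operatorname{angle}_{L^2(0,\infty)}(\varphi_m,\varphi_{m+1})<\varepsilon .$$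
   Context: $\Lambda=\{\lambda_n\}$ is a sequence of complex numbers, possibly with repetitions (finite multiplicities), ordered so that $\operatorname{Re}\lambda_n$ is nondecreasing. A sequence $M$ is uniformly discrete if $\inf_{k\ne n}|\mu_k-\mu_n|>0$. $\Lambda$ is relatively uniformly discrete if it can be decomposed into a finite number of uniformly discrete subsequences (points counted with multiplicity). For $\lambda\in\mathbb C$ let $D_\lambda(r)$ be the disk with center $\lambda$ and radius $r$; let $G^{(p)}(r)$, $p=1,2,\dots$, be the connected components of $\bigcup_{\lambda\in\Lambda}D_\lambda(r)$ and $\Lambda^{(p)}(r)$ the subsequence of those $\lambda_n$ (with multiplicity) lying in $G^{(p)}(r)$; it may be infinite. Given a numbering $\lambda_{1,p},\lambda_{2,p},\dots$ of $\Lambda^{(p)}(r)$, set $\mathcal E^{(p)}(\Lambda,r)=\{[\lambda_{1,p}],[\lambda_{1,p},\lambda_{2,p}],[\lambda_{1,p},\lambda_{2,p},\lambda_{3,p}],\dots\}$ (continued through all points of the group). Generalized divided differences (GDD) of $e^{i\mu t}$: for complex $\mu_1,\dots,\mu_n$, not necessarily distinct, $[\mu_1](t)=e^{i\mu_1t}$ and, for $n\ge2$, $$[\mu_1,\dots,\mu_n]=\frac{[\mu_1,\dots,\mu_{n-1}]-[\mu_2,\dots,\mu_n]}{\mu_1-\mu_n}\ \text{ if }\mu_1\neq\mu_n,\qquad [\mu_1,\dots,\mu_n]=\frac{\partial}{\partial\mu}[\mu,\mu_2,\dots,\mu_{n-1}]\Big|_{\mu=\mu_1}\ \text{ if }\mu_1=\mu_n.$$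 A family $\{f_k\}$ of nonzero vectors in a Hilbert space is uniformly minimal if $\inf_k \operatorname{dist}\big(f_k/\|f_k\|,\ \overline{\operatorname{span}}\{f_j:j\ne k\}\big)>0$. The angle between nonzero vectors $f,g$ is the angle in $[0,\pi/2]$ between the one-dimensional subspaces they span: $\cos\operatorname{angle}(f,g)=|(f,g)|/(\|f\|\|g\|)$. *)

(* Defs.v *)
From mathcomp Require Import all_boot all_order all_algebra.
From mathcomp Require Import all_classical all_reals all_analysis.
From mathcomp Require Import complex.

Set Implicit Arguments.
Unset Strict Implicit.
Unset Printing Implicit Defensive.

Import Order.TTheory GRing.Theory Num.Theory.
Import numFieldNormedType.Exports.
Export numFieldNormedType.Exports.

Local Open Scope classical_set_scope.
Local Open Scope ring_scope.

(* The field of complex numbers packed as a [numFieldType], so that it carries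
   the topology and the normed module structure of its modulus. *)
Definition Cplx (R : realType) : numFieldType := R[i].

Section complex_functions.
Context {R : realType}.
Local Notation C := (Cplx R).
Implicit Types (f g : R -> C) (z : C).

Definition ReC z : R := complex.Re z.
Definition ImC z : R := complex.Im z.
Definition absC z : R := ComplexField.Normc.normc z.
Definition conjC z : C := conjc z.
Definition ofR (x : R) : C := Complex x 0.

Definition cexp z : C :=
  Complex (expR (ReC z) * cos (ImC z)) (expR (ReC z) * sin (ImC z)).

(* [gdd n mu] is the generalized divided difference [mu_0, ..., mu_n] of
   e^{i mu t}; only the first n + 1 terms of [mu] matter. The derivative is
   the complex one. *)
Fixpoint gdd (n : nat) (mu : nat -> C) (t : R) : C :=
  match n with
  | 0%N => cexp (Complex 0 1 * mu 0%N * ofR t)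
  | m.+1 =>
      if mu 0%N == mu m.+1 then
        derive1 (fun z : C => gdd m (fun j => if j == 0%N then z else mu j) t)
                (mu 0%N)
      else (gdd m mu t - gdd m (fun j => mu j.+1) t) / (mu 0%N - mu m.+1)
  end.

(* Elements of the Hilbert space L^2(0, oo) are represented by functions on R,
   of which only the restriction to (0, oo) is relevant. *)
Definition halfline : set R := [set t : R | 0 < t].

Definition L2 f :=
  [/\ measurable_fun halfline (fun t => ReC (f t)),
      measurable_fun halfline (fun t => ImC (f t)) &
      (\int[lebesgue_measure]_(t in halfline) ((absC (f t)) ^+ 2)%:E < +oo)%E].

Definition cintegral f : C :=
  Complex (\int[lebesgue_measure]_(t in halfline) ReC (f t))
          (\int[lebesgue_measure]_(t in halfline) ImC (f t)).

Definition L2dot f g : C := cintegral (fun t => f t * conjC (g t)).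

Definition L2norm f : R :=
  Num.sqrt (\int[lebesgue_measure]_(t in halfline) (absC (f t)) ^+ 2).

Definition L2dist f g : R := L2norm (fun t => f t - g t).

(* When both norms are positive this lies in [0, pi / 2]. *)
Definition L2angle f g : R :=
  acos (absC (L2dot f g) / (L2norm f * L2norm g)).

Definition lin_span (I : Type) (A : set I) (F : I -> R -> C) : set (R -> C) :=
  [set g | exists (n : nat) (c : 'I_n -> C) (k : 'I_n -> I),
     (forall j, A (k j)) /\ g = (fun t => \sum_(j < n) c j * F (k j) t)].

Definition closed_span (I : Type) (A : set I) (F : I -> R -> C) :
    set (R -> C) :=
  [set g | L2 g /\
     forall e : R, 0 < e -> exists2 h, lin_span A F h & L2dist g h < e].

Definition L2setdist f (E : set (R -> C)) : R :=
  inf [set L2dist f g | g in E].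

(* The family [F k], for [k] in [A], is meant to consist of nonzero elements of
   L^2(0, oo). The infimum is extended-real so that it is +oo if [A] is empty. *)
Definition uniformly_minimal (I : Type) (A : set I) (F : I -> R -> C) : Prop :=
  (0 < ereal_inf
     [set (L2setdist (fun t => ofR (L2norm (F k))^-1 * F k t)
                     (closed_span [set j | A j /\ j <> k] F))%:E | k in A])%E.

End complex_functions.

Section sequences_of_points.
Context {R : realType}.
Local Notation C := (Cplx R).
(* A sequence is given by a set [J] of integer indices and the restriction of
   [lambda] to [J]; this covers sequences indexed by nat as well as by int.
   Multiplicities are handled by counting indices rather than values. *)
Implicit Types (lambda : int -> C) (J : set int).

Definition finite_multiplicities J lambda :=
  forall z : C, finite_set [set n | J n /\ lambda n = z].

Definition Re_nondecreasing J lambda :=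
  forall k n : int, J k -> J n -> (k <= n)%R ->
    ReC (lambda k) <= ReC (lambda n).

Definition uniformly_discrete J lambda : Prop :=
  (0 < ereal_inf
     [set d | exists k n : int,
        [/\ J k, J n, k <> n & d = (absC (lambda k - lambda n))%:E]])%E.

Definition relatively_uniformly_discrete J lambda :=
  exists (N : nat) (P : 'I_N -> set int),
    [/\ \bigcup_i P i = J, trivIset setT P &
        forall i, uniformly_discrete (P i) lambda].

Definition disk (z : C) (r : R) : set C := [set w | absC (w - z) < r].

Definition disk_union J lambda (r : R) : set C :=
  \bigcup_(n in J) disk (lambda n) r.

(* The connected components G^(p)(r) are not indexed by p but referred to as
   sets. *)
Definition components J lambda (r : R) : set (set C) :=
  [set connected_component (disk_union J lambda r) z
     | z in disk_union J lambda r].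

(* The indices of the points in the group carried by [G]. *)
Definition group J lambda (G : set C) : set int :=
  [set n | J n /\ G (lambda n)].

(* [nu] restricted to [D] enumerates [A] without repetition; [D] is either
   {0, ..., N - 1} or nat. *)
Definition is_numbering (A : set int) (D : set nat) (nu : nat -> int) :=
  (forall j k : nat, (j <= k)%N -> D k -> D j) /\ set_bij D A nu.

End sequences_of_points.

(* Main.v *)
Require Import Defs.
From mathcomp Require Import all_boot all_order all_algebra.
From mathcomp Require Import all_classical all_reals all_analysis.
From mathcomp Require Import measurable_realfun complex ring lra zify.

(* On the upper half-plane, the divided difference [mu_1, ..., mu_n] solves
   u' = i mu_n u + i [mu_1, ..., mu_(n-1)] with u(0) = 0 for n > 1, and is
   symmetric in its arguments. Since Re (u', u) = 0, pairing this equation with u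
   gives Im mu_n ||u||^2 <= |([mu_1, ..., mu_(n-1)], u)|, so that
     cos angle >= Im mu_n ||[mu_1, ..., mu_n]|| / ||[mu_1, ..., mu_(n-1)]||.
   If the angles stayed away from 0 while the points of a long tight cluster near
   x + iy are appended to K given points, the norm would decrease by a factor at
   most k / y at each step, for some fixed k < 1. But testing against
   e^(ixt - dt), that is, evaluating the Laplace transform, bounds the norm of
   [mu_1, ..., mu_n] below by sqrt(2d) / |z - mu_1| ... |z - mu_n| with
   z = x - id, which decreases by a factor close to 1 / y only. The comparison can
   be started with a constant depending on K only, wherever the K points lie: by
   the resolvent identity, each of them can be removed together with one point of
   the cluster.
   A sequence that is not relatively uniformly discrete contains arbitrarily long
   tight clusters, for otherwise a greedy colouring would split it into uniformly
   discrete parts, and a tight cluster lies in one component. A component with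
   clusters of all sizes is numbered by appending clusters forever, which works
   because the required size depends on the number of preceding points only; in
   any other component a largest cluster comes first. *)

Set Implicit Arguments.
Unset Strict Implicit.
Unset Printing Implicit Defensive.

Import Order.TTheory GRing.Theory Num.Theory.
Import numFieldNormedType.Exports.

Local Open Scope classical_set_scope.
Local Open Scope ring_scope.

(** * Exponentially decaying functions on the half-line *)

Section exponential_decay.
Context {R : realType}.
Implicit Types (f g F : R -> R).
Local Notation mu := (@lebesgue_measure R).

Definition expdecay g :=
  exists C a : R, 0 < a /\ forall t, 0 <= t -> `|g t| <= C * expR (- (a * t)).

(** Decay is asked for t >= 0 only, since a decaying exponential blows up at -oo. The class is
    stable under sums and products, and its members are integrable on the half-line. *)
Definition tame g := continuous g /\ expdecay g.

Lemma expdecayD f g : expdecay f -> expdecay g -> expdecay (fun t => f t + g t).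
Proof.
move=> [C [a [a0 fC]]] [D [b [b0 gD]]].
have C0 : 0 <= C.
  by have := fC 0 (lexx _); rewrite mulr0 oppr0 expR0 mulr1; apply: le_trans.
have D0 : 0 <= D.
  by have := gD 0 (lexx _); rewrite mulr0 oppr0 expR0 mulr1; apply: le_trans.
exists (C + D), (Num.min a b); split; first by rewrite lt_min a0.
move=> t t0; apply: (le_trans (ler_normD _ _)); rewrite mulrDl lerD//.
- apply: (le_trans (fC _ t0)); rewrite ler_wpM2l// ler_expR lerN2.
  by rewrite ler_wpM2r// ge_min lexx.
- apply: (le_trans (gD _ t0)); rewrite ler_wpM2l// ler_expR lerN2.
  by rewrite ler_wpM2r// ge_min lexx orbT.
Qed.

Lemma expdecayM f g : expdecay f -> expdecay g -> expdecay (fun t => f t * g t).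
Proof.
move=> [C [a [a0 fC]]] [D [b [b0 gD]]].
exists (C * D), (a + b); split; first exact: addr_gt0.
move=> t t0; rewrite normrM mulrDl opprD expRD mulrACA ler_pM//; first exact: fC.
exact: gD.
Qed.

Lemma expdecayZ (c : R) g : expdecay g -> expdecay (fun t => c * g t).
Proof.
move=> [C [a [a0 fC]]]; exists (`|c| * C), a; split=> // t t0.
by rewrite normrM -mulrA ler_wpM2l// fC.
Qed.

Lemma tameD f g : tame f -> tame g -> tame (fun t => f t + g t).
Proof.
move=> [cf df] [cg dg]; split; last exact: expdecayD.
by move=> t; apply: cvgD; [exact: cf|exact: cg].
Qed.

Lemma tameM f g : tame f -> tame g -> tame (fun t => f t * g t).
Proof.
move=> [cf df] [cg dg]; split; last exact: expdecayM.
by move=> t; apply: cvgM; [exact: cf|exact: cg].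
Qed.

Lemma tameZ (c : R) g : tame g -> tame (fun t => c * g t).
Proof.
move=> [cg dg]; split; last exact: expdecayZ.
by move=> t; apply: cvgM; [exact: cvg_cst|exact: cg].
Qed.

Lemma tameN g : tame g -> tame (fun t => - g t).
Proof.
move=> /(tameZ (-1)); rewrite (_ : (fun t => -1 * g t) = (fun t => - g t))//.
by apply/funext => t; rewrite mulN1r.
Qed.

Lemma tame0 : tame (fun=> 0).
Proof.
split; first by move=> t; exact: cvg_cst.
by exists 0, 1; split=> // t _; rewrite normr0 mul0r.
Qed.

Lemma is_derive_expRN (a t : R) :
  is_derive t 1 (fun u : R => expR (- (a * u))) (- a * expR (- (a * t))).
Proof.
have h : is_derive t 1 (fun u : R => - (a * u)) (- a).
  have H := is_deriveN (is_deriveZ a (is_derive_id t (1 : R))).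
  by apply: (is_derive_eq H); rewrite /GRing.scale/= mulr1.
have := @is_derive1_comp R expR (fun u : R => - (a * u)) t _ _ _ h.
by move=> /(_ _ (is_derive_expR _)) H; apply: is_derive_eq; rewrite mulrC.
Qed.

Lemma is_derive_ZexpRN (c a t : R) :
  is_derive t 1 (fun u : R => c * expR (- (a * u)))
    (c * (- a * expR (- (a * t)))).
Proof. exact: is_deriveZ (is_derive_expRN a t). Qed.

Lemma tame_expRN (a : R) : 0 < a -> tame (fun t => expR (- (a * t))).
Proof.
move=> a0; split; last first.
  by exists 1, a; split=> // t _; rewrite mul1r ger0_norm ?expR_ge0.
move=> t; apply: differentiable_continuous.
by apply/derivable1_diffP; case: (is_derive_expRN a t).
Qed.

Lemma cvg_expRN_y (a : R) : 0 < a -> expR (- (a * t)) @[t --> +oo] --> (0 : R).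
Proof.
move=> a0; have : (a * t) @[t --> +oo] --> +oo.
  by apply: gt0_cvgMry => //; exact: cvg_id.
by move=> /(@cvg_comp _ _ _ _ _ _ _ _ ) /(_ (@cvgr_expR R)).
Qed.

Lemma expdecay_cvg0 g : expdecay g -> g t @[t --> +oo] --> (0 : R).
Proof.
move=> [C [a [a0 gC]]].
have h : C * expR (- (a * t)) @[t --> +oo] --> (0 : R).
  by rewrite -[X in _ --> X](mulr0 C); apply: cvgM; [exact: cvg_cst|exact: cvg_expRN_y].
apply: (@squeeze_cvgr _ _ _ _ (fun t => - (C * expR (- (a * t))))
  (fun t => C * expR (- (a * t)))).
- near=> t; have := gC t; rewrite ler_norml; apply; near: t.
  by apply: nbhs_pinfty_ge; rewrite num_real.
- by rewrite -oppr0; apply: cvgN.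
- exact: h.
Unshelve. all: by end_near.
Qed.

Lemma halflineE : @halfline R = `]0, +oo[%classic.
Proof. by apply/seteqP; split=> t; rewrite /halfline /= in_itv/= andbT. Qed.

Lemma measurable_halfline : measurable (@halfline R).
Proof. by rewrite halflineE; exact: measurable_itv. Qed.

Lemma tame_measurable g : tame g -> measurable_fun halfline g.
Proof.
move=> [cg _]; apply: measurable_funTS; exact: continuous_measurable_fun.
Qed.

Lemma integrable_expRN (a : R) : 0 < a ->
  mu.-integrable halfline (EFin \o (fun t => expR (- (a * t)))) /\
  \int[mu]_(t in halfline) expR (- (a * t)) = a^-1.
Proof.
move=> a0.
have h : (\int[mu]_(t in `[0%R, +oo[) (expR (- (a * t)))%:E =
    0%:E - (- a^-1 * expR (- (a * 0)))%:E)%E.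
  apply: (@ge0_continuous_FTC2y R _ (fun t => - a^-1 * expR (- (a * t)))).
  - by move=> t _; exact: expR_ge0.
  - by apply: continuous_subspaceT; have [] := tame_expRN a0.
  - rewrite -[X in _ --> X](mulr0 (- a^-1)).
    by apply: cvgM; [exact: cvg_cst|exact: cvg_expRN_y].
  - by move=> t _; case: (is_derive_ZexpRN (- a^-1) a t).
  - apply: cvg_at_right_filter; apply: cvgM; first exact: cvg_cst.
    by have [c _] := tame_expRN a0; exact: c.
  - move=> t _; rewrite derive1E.
    have H := is_derive_ZexpRN (- a^-1) a t.
    by rewrite derive_val; field; rewrite gt_eqF.
have {}h : (\int[mu]_(t in halfline) (expR (- (a * t)))%:E = (a^-1)%:E)%E.
  rewrite halflineE integral_itv_obnd_cbnd.
    by rewrite h mulr0 oppr0 expR0 mulr1 sub0e -EFinN opprK.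
  apply/measurable_EFinP; rewrite -halflineE.
  by apply: tame_measurable; exact: tame_expRN.
split; last by rewrite /Rintegral h.
apply/integrableP; split.
  by apply/measurable_EFinP; apply: tame_measurable; exact: tame_expRN.
suff -> : (\int[mu]_(t in halfline) `|(EFin \o (fun t => expR (- (a * t)))) t| =
  (a^-1)%:E)%E by rewrite ltry.
rewrite -h; apply: eq_integral => t _.
by rewrite /= ger0_norm ?expR_ge0.
Qed.

Lemma tame_integrable g : tame g -> mu.-integrable halfline (EFin \o g).
Proof.
move=> tg; have [_ [C [a [a0 gC]]]] := tg.
have [ie _] := integrable_expRN a0.
apply: (@le_integrable _ _ _ mu _ measurable_halfline _
    (EFin \o (fun t => C * expR (- (a * t))))).
- by apply/measurable_EFinP; exact: tame_measurable.
- move=> t t0 /=; rewrite lee_fin; apply: (le_trans (gC _ (ltW t0))).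
  exact: ler_norm.
- rewrite (_ : _ \o _ = (fun t => C%:E * (EFin \o (fun t => expR (- (a * t)))) t)%E);
    last by apply/funext => t; rewrite /= EFinM.
  by have := @integrableZl _ _ _ mu _ measurable_halfline C _ ie.
Qed.

Notation Ih := (Rintegral mu halfline).

Lemma tame_RintegralD f g : tame f -> tame g -> Ih (fun t => f t + g t) = Ih f + Ih g.
Proof.
move=> tf tg; apply: RintegralD; [exact: measurable_halfline| |];
exact: tame_integrable.
Qed.

Lemma tame_RintegralZ (c : R) g : tame g -> Ih (fun t => c * g t) = c * Ih g.
Proof.
move=> tg; apply: RintegralZl; first exact: measurable_halfline.
exact: tame_integrable.
Qed.

Lemma tame_le_Rintegral f g : tame f -> tame g -> (forall t, 0 < t -> f t <= g t) ->
  Ih f <= Ih g.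
Proof.
move=> tf tg fg; apply: le_Rintegral => //;
  [exact: measurable_halfline|exact: tame_integrable|exact: tame_integrable].
Qed.

(* Adding a multiple of e^(-at) makes the integrand nonnegative, which is what
   the fundamental theorem on unbounded intervals requires. *)
Lemma tame_Rintegral_derive F f : expdecay F -> tame f ->
  (forall t : R, is_derive t (1 : R) F (f t)) -> Ih f = - F 0.
Proof.
move=> dF tf Ff; have [cf [C [a [a0 fC]]]] := tf.
have te := tame_expRN a0.
pose e := fun t : R => C * expR (- (a * t)).
have tfe : tame (fun t => f t + e t) by apply: tameD => //; exact: tameZ.
have h : Ih (fun t => f t + e t) = 0 - (F 0 - C / a).
  rewrite halflineE Rintegral_itv_obnd_cbnd; last first.
    rewrite -halflineE. exact: tame_integrable.
  transitivity (0 - (F 0 + - (C / a) * expR (- (a * 0)))); last first.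
    by rewrite mulr0 oppr0 expR0 mulr1.
  apply: (@Rintegral_ge0_continuous_FTC2y R _
     (fun t => F t + - (C / a) * expR (- (a * t)))).
  - by move=> t /fC; rewrite ler_norml -lerBlDr sub0r => /andP[].
  - by apply: continuous_subspaceT; case: tfe.
  - apply: expdecay_cvg0; apply: expdecayD => //; apply: expdecayZ.
    by case: te.
  - by move=> t _; case: (is_deriveD (Ff t) (is_derive_ZexpRN (- (C / a)) a t)).
  - apply: cvg_at_right_filter; apply: cvgD.
      apply: differentiable_continuous; apply/derivable1_diffP.
      by case: (Ff 0).
    by apply: cvgM; [exact: cvg_cst|case: te => + _; exact].
  - move=> t _; rewrite derive1E.
    have H := is_deriveD (Ff t) (is_derive_ZexpRN (- (C / a)) a t).
    by rewrite derive_val /e; field; rewrite gt_eqF.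
move: h; rewrite tame_RintegralD//; last exact: tameZ.
rewrite tame_RintegralZ// (integrable_expRN a0).2; lra.
Qed.

End exponential_decay.

(** * Calculus of complex-valued functions *)

Section complex_values.
Context {R : realType}.
Local Notation C := (Cplx R).
Implicit Types (x y z mu nu : C) (f g : R -> C).

Definition iC : C := Complex 0 1.

(** The squared modulus as a polynomial in the real and imaginary parts: identities about it reduce
    to [ring] after rewriting with [CE]. *)
Definition sqC z : R := ReC z ^+ 2 + ImC z ^+ 2.

Lemma C_ext z w : ReC z = ReC w -> ImC z = ImC w -> z = w.
Proof. by case: z => a b; case: w => c d /= -> ->. Qed.

Lemma ReCD z w : ReC (z + w) = ReC z + ReC w.
Proof. by case: z => a b; case: w. Qed.
Lemma ImCD z w : ImC (z + w) = ImC z + ImC w.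
Proof. by case: z => a b; case: w. Qed.
Lemma ReCN z : ReC (- z) = - ReC z. Proof. by case: z. Qed.
Lemma ImCN z : ImC (- z) = - ImC z. Proof. by case: z. Qed.
Lemma ReCM z w : ReC (z * w) = ReC z * ReC w - ImC z * ImC w.
Proof. by case: z => a b; case: w. Qed.
Lemma ImCM z w : ImC (z * w) = ReC z * ImC w + ImC z * ReC w.
Proof. by case: z => a b; case: w. Qed.
Lemma ReC0 : ReC (0 : C) = 0. Proof. by []. Qed.
Lemma ImC0 : ImC (0 : C) = 0. Proof. by []. Qed.
Lemma ReC1 : ReC (1 : C) = 1. Proof. by []. Qed.
Lemma ImC1 : ImC (1 : C) = 0. Proof. by []. Qed.
Lemma ReCi : ReC iC = 0. Proof. by []. Qed.
Lemma ImCi : ImC iC = 1. Proof. by []. Qed.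
Lemma ReC_ofR (a : R) : ReC (ofR a) = a. Proof. by []. Qed.
Lemma ImC_ofR (a : R) : ImC (ofR a) = 0. Proof. by []. Qed.
Lemma ReC_conj z : ReC (conjC z) = ReC z. Proof. by case: z. Qed.
Lemma ImC_conj z : ImC (conjC z) = - ImC z. Proof. by case: z. Qed.

Definition CE := (ReCD, ImCD, ReCN, ImCN, ReCM, ImCM, ReC0, ImC0, ReC1, ImC1,
  ReCi, ImCi, ReC_ofR, ImC_ofR, ReC_conj, ImC_conj).

Lemma absC_sq z : absC z ^+ 2 = sqC z.
Proof.
by case: z => a b; rewrite /absC /= sqr_sqrtr// addr_ge0// sqr_ge0.
Qed.

Lemma absC_ge0 z : 0 <= absC z.
Proof. by case: z => a b; rewrite /absC /= sqrtr_ge0. Qed.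

Lemma sqC_ge0 z : 0 <= sqC z.
Proof. by rewrite addr_ge0// sqr_ge0. Qed.

Lemma sqC0 : sqC 0 = 0.
Proof. by rewrite /sqC !CE expr0n addr0. Qed.

Lemma sqC_gt0 z : z != 0 -> 0 < sqC z.
Proof.
move=> z0; rewrite lt_neqAle sqC_ge0 andbT eq_sym; apply: contra z0.
rewrite /sqC paddr_eq0 ?sqr_ge0// !sqrf_eq0 => /andP[/eqP a /eqP b].
by apply/eqP/C_ext; rewrite ?a ?b.
Qed.

Lemma sqCM z w : sqC (z * w) = sqC z * sqC w.
Proof. by rewrite /sqC !CE; ring. Qed.

Lemma absC_sqrt z : absC z = Num.sqrt (sqC z).
Proof. by rewrite -absC_sq sqrtr_sqr ger0_norm// absC_ge0. Qed.

Lemma absC_norm z : (absC z)%:C%C = `|z|.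
Proof. by case: z => a b. Qed.

Lemma absCD z w : absC (z + w) <= absC z + absC w.
Proof.
have := ler_normD z w; rewrite -!absC_norm lecE => /andP[_].
by [].
Qed.

Lemma absCM z w : absC (z * w) = absC z * absC w.
Proof. exact: ComplexField.Normc.normcM. Qed.

Lemma ler_ReC z : `|ReC z| <= absC z.
Proof.
rewrite -[leLHS]sqrtr_sqr absC_sqrt ler_sqrt ?sqC_ge0//.
by rewrite lerDl sqr_ge0.
Qed.

Lemma ler_ImC z : `|ImC z| <= absC z.
Proof.
rewrite -[leLHS]sqrtr_sqr absC_sqrt ler_sqrt ?sqC_ge0//.
by rewrite lerDr sqr_ge0.
Qed.

Lemma ler_absC z : absC z <= `|ReC z| + `|ImC z|.
Proof.
rewrite absC_sqrt -[leRHS]ger0_norm ?addr_ge0// -[leRHS]sqrtr_sqr.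
rewrite ler_sqrt ?sqr_ge0// sqrrD !real_normK ?num_real// /sqC.
by rewrite lerD2r lerDl mulrn_wge0// mulr_ge0.
Qed.

Definition ce mu (t : R) : C := cexp (iC * mu * ofR t).

Lemma ReC_ce mu t : ReC (ce mu t) = expR (- (ImC mu * t)) * cos (ReC mu * t).
Proof.
rewrite /ce /cexp [LHS]/=; congr (expR _ * cos _); rewrite !CE; ring.
Qed.

Lemma ImC_ce mu t : ImC (ce mu t) = expR (- (ImC mu * t)) * sin (ReC mu * t).
Proof.
rewrite /ce /cexp [LHS]/=; congr (expR _ * sin _); rewrite !CE; ring.
Qed.

Lemma ce0 mu : ce mu 0 = 1.
Proof.
by apply: C_ext; rewrite (ReC_ce, ImC_ce) !mulr0 oppr0 expR0 (cos0, sin0) mul1r.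
Qed.

Lemma sqC_ce mu t : sqC (ce mu t) = expR (- (2 * ImC mu * t)).
Proof.
rewrite /sqC ReC_ce ImC_ce !exprMn -mulrDr cos2Dsin2 mulr1.
by rewrite -expRM_natl; congr expR; ring.
Qed.

Lemma ceM_N mu t : ce mu t * ce (- mu) t = 1.
Proof.
apply: C_ext; rewrite !CE !(ReC_ce, ImC_ce) !CE !mulNr cosN sinN opprK.
- transitivity (expR (- (ImC mu * t)) * expR (ImC mu * t) *
     (cos (ReC mu * t) ^+ 2 + sin (ReC mu * t) ^+ 2)); first by ring.
  by rewrite cos2Dsin2 mulr1 -expRD addNr expR0.
- ring.
Qed.

(** Componentwise, so that the real mean value theorem and the real fundamental theorem of calculus
    apply to each part. *)
Definition cderive f (f' : R -> C) := forall t : R,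
  is_derive t (1 : R) (fun u => ReC (f u)) (ReC (f' t)) /\
  is_derive t (1 : R) (fun u => ImC (f u)) (ImC (f' t)).

Lemma cderive_ext f f' g' : (forall t, f' t = g' t) -> cderive f f' ->
  cderive f g'.
Proof. by move=> e h t; rewrite -e. Qed.

Lemma cderiveD f f' g g' : cderive f f' -> cderive g g' ->
  cderive (fun t => f t + g t) (fun t => f' t + g' t).
Proof.
move=> hf hg t; have [f1 f2] := hf t; have [g1 g2] := hg t; split.
- rewrite ReCD (_ : (fun u => _) = (fun u => ReC (f u)) + (fun u => ReC (g u))).
    exact: is_deriveD.
  by apply/funext => u; rewrite ReCD.
- rewrite ImCD (_ : (fun u => _) = (fun u => ImC (f u)) + (fun u => ImC (g u))).
    exact: is_deriveD.
  by apply/funext => u; rewrite ImCD.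
Qed.

Lemma cderiveM f f' g g' : cderive f f' -> cderive g g' ->
  cderive (fun t => f t * g t) (fun t => f' t * g t + f t * g' t).
Proof.
move=> hf hg t; have [f1 f2] := hf t; have [g1 g2] := hg t; split.
- rewrite (_ : (fun u => ReC (f u * g u)) =
     (fun u => ReC (f u)) * (fun u => ReC (g u)) -
     (fun u => ImC (f u)) * (fun u => ImC (g u))); last first.
    by apply/funext => u; rewrite ReCM.
  have H := is_deriveB (is_deriveM f1 g1) (is_deriveM f2 g2).
  by apply: (is_derive_eq H); rewrite !CE /GRing.scale/=; ring.
- rewrite (_ : (fun u => ImC (f u * g u)) =
     (fun u => ReC (f u)) * (fun u => ImC (g u)) +
     (fun u => ImC (f u)) * (fun u => ReC (g u))); last first.
    by apply/funext => u; rewrite ImCM.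
  have H := is_deriveD (is_deriveM f1 g2) (is_deriveM f2 g1).
  by apply: (is_derive_eq H); rewrite !CE /GRing.scale/=; ring.
Qed.

Lemma cderive_cst z : cderive (fun=> z) (fun=> 0).
Proof. by move=> t; split; exact: is_derive_cst. Qed.

Lemma cderiveZ z f f' : cderive f f' -> cderive (fun t => z * f t) (fun t => z * f' t).
Proof.
move=> h; apply: cderive_ext (cderiveM (cderive_cst z) h) => t.
by rewrite mul0r add0r.
Qed.

Lemma cderiveN f f' : cderive f f' -> cderive (fun t => - f t) (fun t => - f' t).
Proof.
move=> /(cderiveZ (-1)) h t; have := h t; rewrite mulN1r.
by under [in X in is_derive _ _ X _ /\ _]eq_fun do rewrite mulN1r;
   under [in X in _ /\ is_derive _ _ X _]eq_fun do rewrite mulN1r.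
Qed.

Lemma cderive_ofR : cderive ofR (fun=> 1).
Proof. by move=> t; split; [exact: is_derive_id|exact: is_derive_cst]. Qed.

Lemma cderive_ofRX k :
  cderive (fun t => ofR t ^+ k) (fun t => k%:R * ofR t ^+ k.-1).
Proof.
elim: k => [|k IH].
  by apply: cderive_ext (cderive_cst 1) => t; rewrite mul0r.
have h := cderiveM cderive_ofR IH.
rewrite (_ : (fun t => ofR t ^+ k.+1) = (fun t => ofR t * ofR t ^+ k)); last first.
  by apply/funext => t; rewrite exprS.
apply: cderive_ext h => t; case: k {IH} => [|k] /=; first by rewrite expr0; ring.
by rewrite exprS; ring.
Qed.

Lemma is_derive_scale (a t : R) : is_derive t (1 : R) (fun u : R => a * u) a.
Proof.
have H := is_deriveZ a (is_derive_id t (1 : R)).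
by apply: (is_derive_eq H); rewrite /GRing.scale/= mulr1.
Qed.

Lemma cderive_ce mu : cderive (ce mu) (fun t => iC * mu * ce mu t).
Proof.
move=> t.
have he := is_derive_expRN (ImC mu) t.
have hs := is_derive_scale (ReC mu) t.
have hc := @is_derive1_comp R _ _ t _ _ (is_derive_cos _) hs.
have hn := @is_derive1_comp R _ _ t _ _ (is_derive_sin _) hs.
split.
- rewrite (_ : (fun u => _) = (fun u => expR (- (ImC mu * u))) *
    (cos \o (fun u => ReC mu * u))); last by apply/funext => u; rewrite ReC_ce.
  apply: (is_derive_eq (is_deriveM he hc)).
  by rewrite !CE ReC_ce ImC_ce /GRing.scale/=; ring.
- rewrite (_ : (fun u => _) = (fun u => expR (- (ImC mu * u))) *
    (sin \o (fun u => ReC mu * u))); last by apply/funext => u; rewrite ImC_ce.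
  apply: (is_derive_eq (is_deriveM he hn)).
  by rewrite !CE ReC_ce ImC_ce /GRing.scale/=; ring.
Qed.

Lemma real_mvt_bound (h h' : R -> R) (B t : R) : 0 <= t ->
  (forall u : R, is_derive u (1 : R) h (h' u)) ->
  (forall u, 0 <= u -> u <= t -> `|h' u| <= B) -> `|h t - h 0| <= B * t.
Proof.
move=> t0 dh hB.
have [|u] := @MVT_segment R h h' 0 t t0 (fun u _ => dh u).
  apply: continuous_subspaceT => u; apply: differentiable_continuous.
  by apply/derivable1_diffP; case: (dh u).
rewrite in_itv/= => /andP[u0 ut] ->; rewrite subr0 normrM (ger0_norm t0).
by rewrite ler_wpM2r// hB.
Qed.

(** The mean value theorem is applied to the real and imaginary parts separately; adding the two
    bounds produces the factor 2. *)
Lemma cderive_bound f f' (B t : R) : 0 <= t -> cderive f f' ->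
  (forall u, 0 <= u -> u <= t -> absC (f' u) <= B) ->
  absC (f t - f 0) <= 2 * B * t.
Proof.
move=> t0 df hB; apply: (le_trans (ler_absC _)); rewrite mulrAC -mulrA mulr_natl.
rewrite mulr2n [t * B]mulrC !CE; apply: lerD.
- apply: (@real_mvt_bound (fun u => ReC (f u)) (fun u => ReC (f' u))) => //.
    by move=> u; case: (df u).
  by move=> u u0 ut; apply: le_trans (hB u u0 ut); exact: ler_ReC.
- apply: (@real_mvt_bound (fun u => ImC (f u)) (fun u => ImC (f' u))) => //.
    by move=> u; case: (df u).
  by move=> u u0 ut; apply: le_trans (hB u u0 ut); exact: ler_ImC.
Qed.

(** The integrating factor e^(-i nu t) cancels the homogeneous term. *)
Lemma cderive_twist nu f g :
  cderive f (fun t => iC * nu * f t + g t) ->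
  cderive (fun t => ce (- nu) t * f t) (fun t => ce (- nu) t * g t).
Proof.
move=> h; apply: cderive_ext (cderiveM (cderive_ce _) h) => t; ring.
Qed.

(** After multiplication by the integrating factor, f has derivative 0 on [0, t]. The source [g] is
    controlled for t >= 0 only, because the sources met below are known to agree only there. *)
Lemma ode_unique nu f g : cderive f (fun t => iC * nu * f t + g t) ->
  (forall t, 0 <= t -> g t = 0) -> f 0 = 0 -> forall t, 0 <= t -> f t = 0.
Proof.
move=> h g0 f0 t t0.
have := @cderive_bound _ _ 0 t t0 (cderive_twist h).
rewrite f0 !mulr0 subr0 mul0r => H.
have {}H : absC (ce (- nu) t * f t) <= 0.
  apply: H => u u0 _.
  by rewrite g0// mulr0 absC_sqrt /sqC !CE expr0n/= addr0 sqrtr0.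
have e : ce (- nu) t * f t = 0.
  apply/eqP; apply: contraTT H => /sqC_gt0; rewrite -ltNge absC_sqrt.
  by rewrite sqrtr_gt0.
by rewrite -[f t]mul1r -(ceM_N nu t) -mulrA e mulr0.
Qed.

End complex_values.

(** * Divided differences as solutions of differential equations *)

Section exponential_polynomials.
Context {R : realType}.
Local Notation C := (Cplx R).
Implicit Types (x y z mu nu : C) (f g : R -> C) (s : seq C).

Definition ctame f := tame (fun t => ReC (f t)) /\ tame (fun t => ImC (f t)).

Lemma ctameD f g : ctame f -> ctame g -> ctame (fun t => f t + g t).
Proof.
move=> [f1 f2] [g1 g2]; split.
- by under eq_fun do rewrite ReCD; exact: tameD.
- by under eq_fun do rewrite ImCD; exact: tameD.
Qed.

Lemma ctameM f g : ctame f -> ctame g -> ctame (fun t => f t * g t).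
Proof.
move=> [f1 f2] [g1 g2]; split.
- by under eq_fun do rewrite ReCM; apply: tameD; [|apply: tameN]; exact: tameM.
- by under eq_fun do rewrite ImCM; apply: tameD; exact: tameM.
Qed.

Lemma ctameZ z f : ctame f -> ctame (fun t => z * f t).
Proof.
move=> [f1 f2]; split.
- by under eq_fun do rewrite ReCM; apply: tameD; [|apply: tameN]; exact: tameZ.
- by under eq_fun do rewrite ImCM; apply: tameD; exact: tameZ.
Qed.

Lemma tame_monoexp k (b : R) : 0 < b -> tame (fun t => t ^+ k * expR (- (b * t))).
Proof.
elim: k b => [|k IH] b b0.
  by under eq_fun do rewrite expr0 mul1r; exact: tame_expRN.
have b20 : 0 < b / 2 by rewrite divr_gt0.
(* Half of the exponential absorbs one factor t, the other half is left to the induction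
   hypothesis. *)
rewrite (_ : (fun t => _) = (fun t => (t * expR (- (b / 2 * t))) *
    (t ^+ k * expR (- (b / 2 * t))))); last first.
  apply/funext => t; rewrite mulrACA -exprS -expRD; congr (_ * expR _); by field.
apply: tameM; last exact: IH.
have b40 : 0 < b / 4 by rewrite divr_gt0.
split.
  move=> t; apply: cvgM; first exact: cvg_id.
  by have [c _] := tame_expRN b20; exact: c.
(* From 1 + x <= e^x at x = bt/4 follows t e^(-bt/4) <= 4/b; the remaining e^(-bt/4) gives the
   decay. *)
exists (b / 4)^-1, (b / 4); split=> // t t0.
rewrite ger0_norm ?mulr_ge0 ?expR_ge0// (_ : b / 2 * t = b / 4 * t + b / 4 * t);
  last by field.
rewrite opprD expRD mulrA ler_wpM2r ?expR_ge0//.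
rewrite expRN ler_pdivrMr ?expR_gt0//.
have h := expR_ge1Dx (b / 4 * t).
rewrite mulrC ler_pdivlMr// mulrC; apply: le_trans h; lra.
Qed.

Lemma tame_bounded (h g : R -> R) : continuous h -> (forall t, `|h t| <= 1) ->
  tame g -> tame (fun t => g t * h t).
Proof.
move=> ch hb [cg [D [a [a0 gD]]]]; split.
  by move=> t; apply: cvgM; [exact: cg|exact: ch].
exists D, a; split=> // t t0; rewrite normrM -[leRHS]mulr1 ler_pM//.
exact: gD.
Qed.

Lemma ctame_mono z k mu : 0 < ImC mu ->
  ctame (fun t => z * ofR t ^+ k * ce mu t).
Proof.
move=> mu0.
have ofRX (t : R) : ofR t ^+ k = ofR (t ^+ k) :> C.
  elim: k => [|k IH]; first by rewrite !expr0; apply: C_ext.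
  by rewrite !exprS IH; apply: C_ext; rewrite !CE; ring.
under eq_fun do rewrite -mulrA.
apply: ctameZ; split.
- rewrite (_ : (fun t => _) = (fun t => t ^+ k * expR (- (ImC mu * t)) *
     cos (ReC mu * t))); last first.
    by apply/funext => t; rewrite ofRX !CE ReC_ce; ring.
  apply: tame_bounded; last exact: tame_monoexp.
    move=> t; apply: continuous_comp; last exact: continuous_cos.
    by apply: cvgM; [exact: cvg_cst|exact: cvg_id].
  by move=> t; rewrite ler_norml cos_geN1 cos_le1.
- rewrite (_ : (fun t => _) = (fun t => t ^+ k * expR (- (ImC mu * t)) *
     sin (ReC mu * t))); last first.
    by apply/funext => t; rewrite ofRX !CE ImC_ce; ring.
  apply: tame_bounded; last exact: tame_monoexp.
    move=> t; apply: continuous_comp; last exact: continuous_sin.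
    by apply: cvgM; [exact: cvg_cst|exact: cvg_id].
  by move=> t; rewrite ler_norml sin_geN1 sin_le1.
Qed.

(** Exponential polynomials with frequencies in the upper half-plane: a class of decaying functions
    in which u' = i nu u + i f can be solved without integral formulas. *)
Inductive expoly : (R -> C) -> Prop :=
| expoly_mono z k mu : 0 < ImC mu ->
    expoly (fun t => z * ofR t ^+ k * ce mu t)
| expoly_add f g : expoly f -> expoly g -> expoly (fun t => f t + g t).

Lemma expoly_ctame f : expoly f -> ctame f.
Proof.
elim=> [z k mu mu0|g h _ tg _ th]; first exact: ctame_mono.
exact: ctameD.
Qed.

Lemma expoly_Zce z mu : 0 < ImC mu -> expoly (fun t => z * ce mu t).
Proof.
move=> /(expoly_mono z 0); rewrite (_ : (fun t => _) = (fun t => z * ce mu t))//.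
by apply/funext => t; rewrite expr0 mulr1.
Qed.

Lemma cderive_mono z k mu : cderive (fun t => z * ofR t ^+ k * ce mu t)
  (fun t => z * k%:R * ofR t ^+ k.-1 * ce mu t +
            iC * mu * (z * ofR t ^+ k * ce mu t)).
Proof.
have h := cderiveM (cderiveZ z (cderive_ofRX k)) (cderive_ce mu).
by apply: cderive_ext h => t; ring.
Qed.

Lemma iC_neq0 : iC != 0 :> C.
Proof. by apply/eqP => /(congr1 ImC) /= /eqP; rewrite oner_eq0. Qed.

(** At resonance, nu = mu, the degree of the monomial rises by one. Otherwise dividing the
    coefficient by mu - nu leaves an error of degree one lower, which induction on [k] removes. *)
Lemma expoly_resolvent_mono k z mu nu : 0 < ImC mu -> 0 < ImC nu ->
  exists2 u, expoly u &
    cderive u (fun t => iC * nu * u t + iC * (z * ofR t ^+ k * ce mu t)).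
Proof.
move=> mu0 nu0; have [->|munu] := eqVneq nu mu.
  exists (fun t => iC * z / k.+1%:R * ofR t ^+ k.+1 * ce mu t).
    exact: expoly_mono.
  apply: cderive_ext (cderive_mono _ _ _) => t /=.
  by field; rewrite ?nat1r ?natr1 pnatr_eq0.
have d0 : mu - nu != 0 by rewrite subr_eq0 eq_sym.
elim: k z => [|k IH] z.
  exists (fun t => z / (mu - nu) * ofR t ^+ 0 * ce mu t); first exact: expoly_mono.
  apply: cderive_ext (cderive_mono _ _ _) => t /=.
  by rewrite expr0; field.
have [v ev dv] := IH (iC * (z * k.+1%:R / (mu - nu))).
exists (fun t => z / (mu - nu) * ofR t ^+ k.+1 * ce mu t + v t).
  by apply: expoly_add => //; exact: expoly_mono.
apply: cderive_ext (cderiveD (cderive_mono _ _ _) dv) => t /=.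
have i2 : iC * iC = -1 :> C by apply: C_ext; rewrite !CE; ring.
rewrite exprS (_ : iC * (iC * _ * _ * _) = (iC * iC) *
  (z * k.+1%:R / (mu - nu) * ofR t ^+ k * ce mu t)); last by ring.
by rewrite i2; field.
Qed.

Lemma expoly_resolvent z f nu : expoly f -> 0 < ImC nu ->
  exists u, [/\ expoly u, cderive u (fun t => iC * nu * u t + iC * f t) & u 0 = z].
Proof.
move=> ef nu0.
have [u eu du] : exists2 u, expoly u &
    cderive u (fun t => iC * nu * u t + iC * f t).
  elim: ef => [{}z k mu mu0|g h _ [u eu du] _ [v ev dv]].
    exact: expoly_resolvent_mono.
  exists (fun t => u t + v t); first exact: expoly_add.
  by apply: cderive_ext (cderiveD du dv) => t; ring.
(* A multiple of the homogeneous solution adjusts the initial value. *)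
exists (fun t => u t + (z - u 0) * ce nu t); split.
- by apply: expoly_add => //; exact: expoly_Zce.
- apply: cderive_ext (cderiveD du (cderiveZ (z - u 0) (cderive_ce nu))) => t.
  ring.
- by rewrite ce0; ring.
Qed.

(* [edd s] is the divided difference of e^(i mu t) at the points of [s], defined
   by the differential equation it satisfies; it is meaningful for points in the
   upper half-plane and t >= 0 only. *)
Fixpoint edd s : R -> C :=
  if s is nu :: s' then
    get [set u | [/\ expoly u,
      cderive u (fun t => iC * nu * u t + iC * edd s' t) &
      u 0 = (if s' is [::] then 1 else 0)]]
  else fun=> 0.

Definition upper s := all (fun z => 0 < ImC z) s.

Lemma eddP s : upper s -> expoly (edd s) /\
  (forall nu s', s = nu :: s' ->
    cderive (edd s) (fun t => iC * nu * edd s t + iC * edd s' t) /\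
    edd s 0 = (if s' is [::] then 1 else 0)).
Proof.
elim: s => [_|nu s IH /= /andP[nu0 us]].
  split=> //; have -> : edd [::] = (fun t : R => 0 * ce iC t).
    by apply/funext => t; rewrite mul0r.
  by apply: expoly_Zce; rewrite /= ltr01.
have [es _] := IH us.
have [u hu] := @expoly_resolvent (if s is [::] then 1 else 0) _ _ es nu0.
have [] := getPex (P := [set u | [/\ expoly u,
      cderive u (fun t => iC * nu * u t + iC * edd s t) &
      u 0 = (if s is [::] then 1 else 0)]]) (ex_intro _ u hu).
by move=> h1 h2 h3; split=> // _ _ [<- <-].
Qed.

Lemma edd_expoly s : upper s -> expoly (edd s).
Proof. by move=> /eddP[]. Qed.

Lemma edd_ctame s : upper s -> ctame (edd s).
Proof. by move=> /edd_expoly/expoly_ctame. Qed.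

Lemma edd_cderive nu s : upper (nu :: s) ->
  cderive (edd (nu :: s)) (fun t => iC * nu * edd (nu :: s) t + iC * edd s t).
Proof. by move=> /eddP[_ /(_ nu s erefl)[]]. Qed.

Lemma edd0 nu s : upper (nu :: s) ->
  edd (nu :: s) 0 = (if s is [::] then 1 else 0).
Proof. by move=> /eddP[_ /(_ nu s erefl)[]]. Qed.

Lemma edd1 nu : 0 < ImC nu -> forall t, 0 <= t -> edd [:: nu] t = ce nu t.
Proof.
move=> nu0 t t0; have u : upper [:: nu] by rewrite /= nu0.
apply/eqP; rewrite -subr_eq0; apply/eqP.
apply: (@ode_unique _ nu (fun t => edd [:: nu] t - ce nu t) (fun=> 0)) => //.
  apply: cderive_ext (cderiveD (edd_cderive u) (cderiveN (cderive_ce nu))) => w.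
  by rewrite /=; ring.
by rewrite edd0// ce0 subrr.
Qed.

(** The recurrence of divided differences, in a form that also covers z = w. In the difference of
    the two sides the sources i [s] cancel, and (z - w) i [w, s] turns the rate w into z; so it
    solves the homogeneous equation with rate z and vanishes at 0. *)
Lemma edd_diff z w s t : upper (z :: w :: s) -> 0 <= t ->
  (z - w) * edd (z :: w :: s) t = edd (z :: s) t - edd (w :: s) t.
Proof.
move=> u t0; have /andP[z0 /andP[w0 us]] := u.
have uz : upper (z :: s) by rewrite /= z0.
have uw : upper (w :: s) by rewrite /= w0.
apply/eqP; rewrite -subr_eq0; apply/eqP.
apply: (@ode_unique _ z (fun t => (z - w) * edd (z :: w :: s) t -
  (edd (z :: s) t - edd (w :: s) t)) (fun=> 0)) => //.
  have h := cderiveD (cderiveZ (z - w) (edd_cderive u))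
    (cderiveN (cderiveD (edd_cderive uz) (cderiveN (edd_cderive uw)))).
  by apply: cderive_ext h => v; ring.
by rewrite !edd0//; case: s {u us uz uw} => [|? ?]; ring.
Qed.

(** Both z - w and the right-hand side of [edd_diff] change sign under the swap. *)
Lemma edd_swap z w s t : upper (z :: w :: s) -> 0 <= t ->
  edd (z :: w :: s) t = edd (w :: z :: s) t.
Proof.
move=> u t0; have [->//|zw] := eqVneq z w.
have u' : upper (w :: z :: s).
  by move: u => /= /and3P[-> -> ->].
have d0 : z - w != 0 by rewrite subr_eq0.
apply: (mulfI d0); rewrite edd_diff// -(opprB w z) mulNr edd_diff//; ring.
Qed.

(** The tail enters the equation as a source, and the initial value through its emptiness, hence the
    condition with [nilp]. *)
Lemma edd_cons_ext nu s s' : upper (nu :: s) -> upper (nu :: s') ->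
  nilp s = nilp s' ->
  (forall t, 0 <= t -> edd s t = edd s' t) ->
  forall t, 0 <= t -> edd (nu :: s) t = edd (nu :: s') t.
Proof.
move=> u u' ss h t t0.
apply/eqP; rewrite -subr_eq0; apply/eqP.
apply: (@ode_unique _ nu (fun t => edd (nu :: s) t - edd (nu :: s') t)
  (fun t => iC * (edd s t - edd s' t))) => //.
- apply: cderive_ext (cderiveD (edd_cderive u) (cderiveN (edd_cderive u'))) => v.
  ring.
- by move=> v v0; rewrite h// subrr mulr0.
- rewrite !edd0//; case: s s' ss {h u u'} => [|? ?] [|? ?]//= _; exact: subrr.
Qed.

Lemma upper_perm s s' : perm_eq s s' -> upper s = upper s'.
Proof. exact: perm_all. Qed.

Lemma edd_front s1 z s2 : upper (s1 ++ z :: s2) ->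
  forall t, 0 <= t -> edd (s1 ++ z :: s2) t = edd (z :: s1 ++ s2) t.
Proof.
elim: s1 => [//|w s1 IH] u t t0.
have p : perm_eq (s1 ++ z :: s2) (z :: s1 ++ s2).
  exact: (permEl (perm_catCA s1 [:: z] s2)).
have u' : upper (w :: z :: s1 ++ s2).
  by move: u => /= /andP[->]; rewrite (upper_perm p).
rewrite -edd_swap//; apply: edd_cons_ext => //=.
- by rewrite /nilp size_cat addnS.
- by apply: IH; move: u => /= /andP[].
Qed.

Lemma edd_perm s s' : upper s -> perm_eq s s' ->
  forall t, 0 <= t -> edd s t = edd s' t.
Proof.
elim: s s' => [|z s IH] s' us; first by move=> /perm_size/esym/size0nil ->.
move=> p; have us' : upper s' by rewrite -(upper_perm p).
have /splitPr zs' : z \in s' by rewrite -(perm_mem p) mem_head.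
case: zs' p us' => s1 s2 p us' t t0.
have p' : perm_eq s (s1 ++ s2).
  by move: p; rewrite (permPr (permEl (perm_catCA s1 [:: z] s2))) perm_cons.
rewrite edd_front//; apply: edd_cons_ext => //.
- by move: us; rewrite /= (upper_perm p').
- by rewrite /nilp (perm_size p').
- by apply: IH => //; move: us => /= /andP[].
Qed.

(* The bound is uniform in [z], since the equation for [edd (z :: s)] only
   involves [z] through a bounded exponential. *)
Lemma edd_locally_bounded (a : C) s t : 0 < ImC a -> upper s -> 0 <= t ->
  exists2 B : R, 0 <= B & forall z, absC (z - a) < ImC a ->
    absC (edd (z :: s) t) <= B.
Proof.
move=> a0 us t0.
have [[_ [C1 [b1 [b10 h1]]]] [_ [C2 [b2 [b20 h2]]]]] := edd_ctame us.
have C10 : 0 <= C1.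
  by have := h1 0 (lexx _); rewrite mulr0 oppr0 expR0 mulr1; apply: le_trans.
have C20 : 0 <= C2.
  by have := h2 0 (lexx _); rewrite mulr0 oppr0 expR0 mulr1; apply: le_trans.
have sb u : 0 <= u -> absC (edd s u) <= C1 + C2.
  move=> u0; apply: (le_trans (ler_absC _)); apply: lerD.
    apply: (le_trans (h1 _ u0)); rewrite -[leRHS]mulr1 ler_wpM2l//.
    by rewrite -expR0 ler_expR oppr_le0 mulr_ge0// ltW.
  apply: (le_trans (h2 _ u0)); rewrite -[leRHS]mulr1 ler_wpM2l//.
  by rewrite -expR0 ler_expR oppr_le0 mulr_ge0// ltW.
(* Since Im z < 2 Im a, this bounds the derivative of e^(-izu) times the solution on [0, t]; the
   summand 1 below accounts for the initial value. *)
pose B1 := expR (2 * ImC a * t) * (C1 + C2).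
have B10 : 0 <= B1 by rewrite mulr_ge0 ?expR_ge0 ?addr_ge0.
exists (1 + 2 * B1 * t).
  by apply: addr_ge0; [exact: ler01|apply: mulr_ge0 => //; apply: mulr_ge0].
move=> z za.
have := ler_ImC (z - a); rewrite !CE => /le_lt_trans/(_ za).
rewrite ltr_norml => /andP[za1 za2].
have z0 : 0 < ImC z by lra.
have uz : upper (z :: s) by rewrite /= z0.
have ce_abs w u : absC (ce w u) = expR (- (ImC w * u)).
  rewrite absC_sqrt sqC_ce -[RHS]ger0_norm ?expR_ge0// -sqrtr_sqr.
  by rewrite -expRM_natl; congr (Num.sqrt (expR _)); ring.
have iC_abs : absC iC = 1 :> R.
  by rewrite absC_sqrt /sqC !CE expr0n expr1n add0r sqrtr1.
have h := @cderive_bound _ _ _ B1 t t0 (cderive_twist (edd_cderive uz)).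
have {}h : absC (ce (- z) t * edd (z :: s) t - ce (- z) 0 * edd (z :: s) 0)
    <= 2 * B1 * t.
  apply: h => u u0 ut; rewrite !absCM iC_abs mul1r ce_abs CE.
  rewrite ler_pM ?expR_ge0 ?absC_ge0 ?sb//.
  rewrite ler_expR mulNr opprK ler_pM//; lra.
have e0 : absC (ce (- z) 0 * edd (z :: s) 0) <= 1.
  rewrite ce0 mul1r edd0//; case: (s) => [|? ?]; rewrite absC_sqrt /sqC !CE.
    by rewrite expr0n expr1n addr0 sqrtr1.
  by rewrite expr0n addr0 sqrtr0.
have -> : edd (z :: s) t = ce z t * (ce (- z) t * edd (z :: s) t -
  ce (- z) 0 * edd (z :: s) 0 + ce (- z) 0 * edd (z :: s) 0).
  by rewrite subrK mulrA ceM_N mul1r.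
rewrite absCM ce_abs -[leRHS]mul1r ler_pM ?expR_ge0 ?absC_ge0//.
  by rewrite -expR0 ler_expR oppr_le0 mulr_ge0// ltW.
by rewrite [leRHS]addrC; apply: (le_trans (absCD _ _)); exact: lerD.
Qed.

End exponential_polynomials.
Arguments edd {R} _ _ : simpl never.

(** * Identification with the generalized divided differences *)

Section gdd_edd.
Context {R : realType}.
Local Notation C := (Cplx R).
Implicit Types (z : C) (s : seq C).

Lemma near0_absC (d : R) : 0 < d -> \forall h \near (0 : C)^', absC h < d.
Proof.
move=> d0; have d0' : (0 : C) < Complex d 0 by rewrite ltcE /= eqxx.
have := @dnbhs0_lt C C _ d0'; apply: filterS => h.
by rewrite -absC_norm ltcE /= => /andP[].
Qed.

(** By [edd_diff] the difference quotient is [a + h, a, s], which differs from [a, a, s] by h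
    [a + h, a, a, s]; the last divided difference stays bounded as h tends to 0. *)
Lemma edd_derive1 (a : C) s t (g : C -> C) : 0 < ImC a -> upper s -> 0 <= t ->
  (forall z, 0 < ImC z -> g z = edd (z :: s) t) ->
  derive1 g a = edd (a :: a :: s) t.
Proof.
move=> a0 us t0 gE; have ua : upper (a :: s) by rewrite /= a0.
have uaa : upper (a :: a :: s) by rewrite /= a0.
have [B B0 hB] := edd_locally_bounded a0 uaa t0.
rewrite /derive1; apply: cvg_lim; first exact: norm_hausdorff.
apply/cvgrPdist_le => e e0.
have re0 : 0 < complex.Re e by move: e0; rewrite ltcE => /andP[].
have ie0 : complex.Im e = 0 by move: e0; rewrite ltcE => /andP[/eqP].
have d0 : 0 < complex.Re e / (B + 1) by rewrite divr_gt0// ltr_wpDl.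
have hn : \forall h \near (0 : C)^', h != 0 by exact: nbhs_dnbhs_neq.
have h1 := near0_absC a0; have h2 := near0_absC d0.
near=> h.
have h0 : h != 0 by near: h.
have ha : absC h < ImC a by near: h.
have hd : absC h < complex.Re e / (B + 1) by near: h.
have ih : 0 < ImC (h + a).
  have := ler_ImC h; move=> /le_lt_trans/(_ ha); rewrite ltr_norml !CE.
  by move=> /andP[]; lra.
have u1 : upper [:: h + a, a & s] by rewrite /= ih.
have u2 : upper [:: h + a, a, a & s] by rewrite /= ih.
have E1 : h^-1 *: (g (h + a) - g a) = edd [:: h + a, a & s] t.
  rewrite !gE// -edd_diff// addrK /GRing.scale/=.
  by rewrite mulrA mulVf// mul1r.
have E2 : edd [:: a, a & s] t - edd [:: h + a, a & s] t =
    - (h * edd [:: h + a, a, a & s] t).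
  by rewrite -[h in h * _](addrK a) edd_diff// opprB.
rewrite [X in _ - X]E1 E2 normrN -absC_norm lecE ie0 eqxx /= absCM.
have := hB (h + a); rewrite addrK => /(_ ha) hb.
apply: (@le_trans _ _ (complex.Re e / (B + 1) * B)).
  by rewrite ler_pM ?absC_ge0// ltW.
by rewrite mulrAC ler_pdivrMr ?ltr_wpDl// ler_wpM2l ?ltW// ltr_pwDr.
Unshelve. all: by end_near.
Qed.

Lemma mkseqS_cons (T : Type) (mu : nat -> T) n :
  mkseq mu n.+1 = mu 0%N :: mkseq (fun j => mu j.+1) n.
Proof.
by rewrite /mkseq /= -[1%N]/(1 + 0)%N iotaDl -map_comp.
Qed.

(** [gdd] takes differences in its first and last points, [edd_diff] in the first two; symmetry
    moves the last point to second place. *)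
Lemma gddE n (mu : nat -> C) t : 0 <= t ->
  (forall j, (j <= n)%N -> 0 < ImC (mu j)) ->
  gdd n mu t = edd (mkseq mu n.+1) t.
Proof.
move=> t0; elim: n mu => [|m IH] mu pmu.
  by symmetry; apply: (@edd1 R (mu 0%N)) => //; exact: pmu.
have pS j : (j <= m)%N -> 0 < ImC (mu j.+1) by move=> jm; exact: pmu.
have p0 : 0 < ImC (mu 0%N) by exact: pmu.
have um : upper (mkseq (fun j => mu j.+1) m).
  by apply/allP => _ /mapP[j + ->]; rewrite mem_iota add0n => jm; apply/pS/ltnW.
have E : mkseq mu m.+2 = mu 0%N :: rcons (mkseq (fun j => mu j.+1) m) (mu m.+1).
  by rewrite mkseqS_cons -mkseqS.
have ul : upper (mu 0%N :: mu m.+1 :: mkseq (fun j => mu j.+1) m).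
  by rewrite /= p0 pS.
have -> : edd (mkseq mu m.+2) t =
    edd (mu 0%N :: mu m.+1 :: mkseq (fun j => mu j.+1) m) t.
  rewrite E; symmetry; apply: edd_perm => //.
  by rewrite perm_cons perm_sym perm_rcons.
rewrite /=; case: eqVneq => [e|ne].
  rewrite -e; apply: edd_derive1 => // z z0.
  rewrite IH; first by rewrite mkseqS_cons.
  by case=> [|j] jm //=; exact/pS/ltnW.
rewrite IH; last by move=> j jm; apply: pmu; exact: leqW.
rewrite IH//.
rewrite mkseqS_cons mkseqS (_ : edd (rcons _ _) t =
  edd (mu m.+1 :: mkseq (fun j => mu j.+1) m) t); last first.
  symmetry; apply: edd_perm => //; last by rewrite perm_sym perm_rcons.
  by rewrite /= pS.
rewrite -edd_diff// mulrAC mulfV ?mul1r//.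
by rewrite subr_eq0.
Qed.

End gdd_edd.

(** * Estimates in L^2(0, oo) *)

Section inner_product.
Context {R : realType}.
Local Notation C := (Cplx R).
Implicit Types (z w nu : C) (s : seq C) (f g u : R -> C).
Local Notation Ih := (Rintegral (@lebesgue_measure R) halfline).

Definition L2sq f : R := Ih (fun t => sqC (f t)).

Lemma ctame_conj f : ctame f -> ctame (fun t => conjC (f t)).
Proof.
move=> [f1 f2]; split.
- by under eq_fun do rewrite ReC_conj.
- by under eq_fun do rewrite ImC_conj; exact: tameN.
Qed.

Lemma ctame_dot f g : ctame f -> ctame g -> ctame (fun t => f t * conjC (g t)).
Proof. by move=> tf tg; apply: ctameM => //; exact: ctame_conj. Qed.

Lemma ctame_sqC f : ctame f -> tame (fun t => sqC (f t)).
Proof.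
by move=> [f1 f2]; apply: tameD; apply: tameM.
Qed.

Lemma L2sq_ge0 f : 0 <= L2sq f.
Proof. by apply: Rintegral_ge0 => t _; exact: sqC_ge0. Qed.

Lemma cintegralD f g : ctame f -> ctame g ->
  cintegral (fun t => f t + g t) = cintegral f + cintegral g.
Proof.
move=> [f1 f2] [g1 g2]; apply: C_ext; rewrite !CE /=.
- by under eq_fun do rewrite ReCD; exact: tame_RintegralD.
- by under eq_fun do rewrite ImCD; exact: tame_RintegralD.
Qed.

Lemma cintegralZ z f : ctame f -> cintegral (fun t => z * f t) = z * cintegral f.
Proof.
move=> [f1 f2]; apply: C_ext; rewrite !CE /=.
- under eq_fun do rewrite ReCM -mulNr.
  by rewrite tame_RintegralD ?tame_RintegralZ ?mulNr//; exact: tameZ.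
- under eq_fun do rewrite ImCM.
  by rewrite tame_RintegralD ?tame_RintegralZ//; exact: tameZ.
Qed.

Lemma cintegral_derive F f : ctame F -> ctame f -> cderive F f ->
  cintegral f = - F 0.
Proof.
move=> [[_ F1] [_ F2]] [f1 f2] dF; apply: C_ext; rewrite CE /=.
- by apply: (tame_Rintegral_derive F1) => // t; case: (dF t).
- by apply: (tame_Rintegral_derive F2) => // t; case: (dF t).
Qed.

Lemma L2sqZ z f : ctame f -> L2sq (fun t => z * f t) = sqC z * L2sq f.
Proof.
move=> tf; rewrite /L2sq; under eq_fun do rewrite sqCM.
by rewrite tame_RintegralZ//; exact: ctame_sqC.
Qed.

Lemma L2sq_addZ z f g : ctame f -> ctame g ->
  L2sq (fun t => f t + z * g t) =
  L2sq f + 2 * ReC (conjC z * L2dot f g) + sqC z * L2sq g.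
Proof.
move=> tf tg; have [d1 d2] := ctame_dot tf tg.
rewrite /L2sq (_ : (fun t => sqC (f t + z * g t)) = (fun t => sqC (f t) +
  (2 * ReC z * ReC (f t * conjC (g t)) + (2 * ImC z * ImC (f t * conjC (g t)) +
  sqC z * sqC (g t))))); last first.
  by apply/funext => t; rewrite /sqC !CE; ring.
have tF := ctame_sqC tf; have tG := ctame_sqC tg.
have tz := tameZ (sqC z) tG.
have t2 := tameZ (2 * ImC z) d2; have t1 := tameZ (2 * ReC z) d1.
have t3 := tameD t2 tz.
rewrite (tame_RintegralD tF (tameD t1 t3)) (tame_RintegralD t1 t3).
rewrite (tame_RintegralD t2 tz) !tame_RintegralZ//.
rewrite [L2dot f g]/L2dot !CE /=; ring.
Qed.

Lemma L2sq_sub_le f g : ctame f -> ctame g ->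
  L2sq (fun t => f t - g t) <= 2 * L2sq f + 2 * L2sq g.
Proof.
move=> tf tg; have tF := ctame_sqC tf; have tG := ctame_sqC tg.
have tg' : ctame (fun t => - g t).
  by under eq_fun do rewrite -mulN1r; exact: ctameZ.
have -> : 2 * L2sq f + 2 * L2sq g = Ih (fun t => 2 * sqC (f t) + 2 * sqC (g t)).
  by rewrite tame_RintegralD ?tame_RintegralZ//; exact: tameZ.
apply: tame_le_Rintegral; first by apply: ctame_sqC; exact: ctameD.
  by apply: tameD; exact: tameZ.
move=> t _; rewrite /sqC !CE.
have := sqr_ge0 (ReC (f t) + ReC (g t)).
have := sqr_ge0 (ImC (f t) + ImC (g t)); lra.
Qed.

Lemma sqC_ofR (a : R) : sqC (ofR a) = a ^+ 2.
Proof. by rewrite /sqC !CE expr0n /= addr0. Qed.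

(** Pythagoras for the projection onto the line of [g], used for the Cauchy-Schwarz inequality and
    for the distance to a span. *)
Lemma L2sq_proj f g : ctame f -> ctame g -> 0 < L2sq g ->
  L2sq (fun t => f t + - (ofR (L2sq g)^-1 * L2dot f g) * g t) =
  L2sq f - sqC (L2dot f g) / L2sq g.
Proof.
move=> tf tg g0; rewrite L2sq_addZ// /sqC !CE.
by field; rewrite gt_eqF.
Qed.

Lemma cauchy_schwarz f g : ctame f -> ctame g -> 0 < L2sq g ->
  sqC (L2dot f g) <= L2sq f * L2sq g.
Proof.
move=> tf tg g0.
have := L2sq_ge0 (fun t => f t + - (ofR (L2sq g)^-1 * L2dot f g) * g t).
by rewrite L2sq_proj// subr_ge0 ler_pdivrMr.
Qed.

Lemma ce_ctame nu : 0 < ImC nu -> ctame (ce nu).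
Proof.
move=> nu0; apply: expoly_ctame; have := expoly_Zce 1 nu0.
by under eq_fun do rewrite mul1r.
Qed.

(* This is the integral of the derivative of |edd (nu :: s)|^2. *)
Lemma edd_dot_energy nu s : upper (nu :: s) ->
  2 * ImC nu * L2sq (edd (nu :: s)) + 2 * ImC (L2dot (edd s) (edd (nu :: s))) =
  sqC (edd (nu :: s) 0).
Proof.
move=> us; have us' : upper s by move: us => /= /andP[].
have tu := edd_ctame us; have tf := edd_ctame us'.
set u := edd (nu :: s) in tu *; set f := edd s in tf *.
have tq := ctame_sqC tu; have [_ td] := ctame_dot tf tu.
have := @tame_Rintegral_derive R (fun t => sqC (u t))
  (fun t => (- 2 * ImC nu) * sqC (u t) + -2 * ImC (f t * conjC (u t))).
rewrite tame_RintegralD ?tame_RintegralZ//; [|exact: tameZ|exact: tameZ] => H.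
have {}H : - 2 * ImC nu * L2sq u + -2 * ImC (L2dot f u) = - sqC (u 0).
  apply: H; [by case: tq|by apply: tameD; exact: tameZ|move=> t].
  have [d1 d2] := edd_cderive us t.
  have D := is_deriveD (is_deriveM d1 d1) (is_deriveM d2 d2).
  rewrite -/u -/f in D.
  by apply: (is_derive_eq D); rewrite !CE /GRing.scale/= /sqC; ring.
by lra.
Qed.

Lemma L2sq_ce nu : 0 < ImC nu -> L2sq (ce nu) = (2 * ImC nu)^-1.
Proof.
move=> nu0; rewrite /L2sq; under eq_fun do rewrite sqC_ce.
by rewrite (integrable_expRN _).2// mulr_gt0.
Qed.

(** As [s] is not empty, the initial value is 0 and the energy identity gives Im ([s], u) = - Im nu
    ||u||^2; the modulus dominates the imaginary part. *)
Lemma edd_dot_ge nu s : upper (nu :: s) -> s != [::] ->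
  ImC nu ^+ 2 * L2sq (edd (nu :: s)) ^+ 2 <=
  sqC (L2dot (edd s) (edd (nu :: s))).
Proof.
move=> us s0; have := edd_dot_energy us.
rewrite edd0//; case: s s0 us => [//|z s] _ us.
rewrite sqC0 /sqC => h.
have -> : ImC (L2dot (edd (z :: s)) (edd [:: nu, z & s])) =
   - (ImC nu * L2sq (edd [:: nu, z & s])) by lra.
by rewrite sqrrN exprMn lerDr sqr_ge0.
Qed.

Lemma conj_ce w t : conjC (ce w t) = ce (- conjC w) t.
Proof.
apply: C_ext; rewrite !CE !(ReC_ce, ImC_ce) !CE opprK !mulNr; [|rewrite sinN mulrN].
- by rewrite cosN.
- by [].
Qed.

(** Pairing with e^(iwt) is a Laplace transform, which turns the differential equation into
    multiplication by conj w - nu. The initial value contributes at the last remaining point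
    only. *)
Lemma edd_dot_ce w s : 0 < ImC w -> upper s -> s != [::] ->
  sqC (L2dot (edd s) (ce w)) * \prod_(nu <- s) sqC (conjC w - nu) = 1.
Proof.
move=> w0; elim: s => [//|nu s IH] us _.
have us' : upper s by move: us => /= /andP[].
have tu := edd_ctame us; have tf := edd_ctame us'.
have tg := ce_ctame w0.
have dg : cderive (fun t => conjC (ce w t)) (fun t => - iC * conjC w * conjC (ce w t)).
  under eq_fun do rewrite conj_ce.
  apply: cderive_ext (cderive_ce _) => t; rewrite conj_ce; ring.
have h := cderiveM (edd_cderive us) dg.
have tug := ctame_dot tu tg; have tfg := ctame_dot tf tg.
have {}h : cderive (fun t => edd (nu :: s) t * conjC (ce w t))
  (fun t => iC * (nu - conjC w) * (edd (nu :: s) t * conjC (ce w t)) +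
     iC * (edd s t * conjC (ce w t))).
  by apply: cderive_ext h => t; ring.
have := cintegral_derive tug _ h.
have t1 := ctameZ (iC * (nu - conjC w)) tug.
have t2 := ctameZ iC tfg.
rewrite cintegralD// !cintegralZ//.
rewrite -/(L2dot (edd (nu :: s)) (ce w)) -/(L2dot (edd s) (ce w)).
move=> /(_ (ctameD t1 t2)) E.
have {E} : (conjC w - nu) * L2dot (edd (nu :: s)) (ce w) =
    L2dot (edd s) (ce w) - iC * (edd (nu :: s) 0 * conjC (ce w 0)).
  apply: (mulfI (@iC_neq0 R)).
  have i2 : iC * iC = -1 :> C by apply: C_ext; rewrite !CE; ring.
  set D1 := L2dot (edd (nu :: s)) _ in E *; set D0 := L2dot (edd s) _ in E *.
  transitivity (iC * D0 - (iC * (nu - conjC w) * D1 + iC * D0)); first by ring.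
  rewrite E opprK.
  transitivity (iC * D0 - iC * iC * (edd (nu :: s) 0 * conjC (ce w 0))).
    by rewrite i2; ring.
  ring.
have c1 : conjC (ce w 0) = 1 :> C by rewrite ce0; apply: C_ext; rewrite !CE// oppr0.
rewrite c1 mulr1 edd0// big_cons => E.
case: s IH us us' {tu tf h tug tfg t1 t2} E => [|z s] IH us us' E.
- have e0 : L2dot (edd [::]) (ce w) = 0 :> C.
    rewrite /L2dot; under eq_fun do rewrite mul0r.
    by apply: C_ext; rewrite !CE /=; have := @tame_RintegralZ R 0 _ tame0;
      under eq_fun do rewrite mul0r; rewrite mul0r.
  move: (congr1 sqC E); rewrite e0 mulr1 sub0r sqCM big_nil mulr1 mulrC => ->.
  by rewrite /sqC !CE oppr0 expr0n add0r sqrrN expr1n.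
- move: (congr1 sqC E); rewrite mulr0 subr0 sqCM => e.
  by rewrite mulrA [_ * sqC (_ - nu)]mulrC e; exact: IH.
Qed.

Lemma L2sq_edd_ge w s : 0 < ImC w -> upper s -> s != [::] ->
  2 * ImC w <= L2sq (edd s) * \prod_(nu <- s) sqC (conjC w - nu).
Proof.
move=> w0 us s0; have h := edd_dot_ce w0 us s0.
have g0 : 0 < L2sq (ce w) by rewrite L2sq_ce// invr_gt0 mulr_gt0.
have := cauchy_schwarz (edd_ctame us) (ce_ctame w0) g0.
rewrite L2sq_ce// => hc.
have p0 : 0 <= \prod_(nu <- s) sqC (conjC w - nu).
  by apply: prodr_ge0 => nu _; exact: sqC_ge0.
have := ler_wpM2r p0 hc; rewrite h mulrAC ler_pdivlMr ?mulr_gt0//.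
by rewrite mul1r.
Qed.

Lemma L2sq_edd_gt0 s : upper s -> s != [::] -> 0 < L2sq (edd s).
Proof.
move=> us s0; rewrite lt_neqAle L2sq_ge0 andbT eq_sym; apply/eqP => e.
have i0 : 0 < ImC iC :> R by rewrite ltr01.
by have := L2sq_edd_ge i0 us s0; rewrite e mul0r leNgt mulr_gt0.
Qed.

Lemma L2sq_edd_cons nu s : upper (nu :: s) -> s != [::] ->
  ImC nu ^+ 2 * L2sq (edd (nu :: s)) <= L2sq (edd s).
Proof.
move=> us s0; have us' : upper s by move: us => /= /andP[].
have u0 := L2sq_edd_gt0 us isT.
have := le_trans (edd_dot_ge us s0)
  (cauchy_schwarz (edd_ctame us') (edd_ctame us) u0).
by rewrite expr2 mulrA ler_pM2r.
Qed.

Lemma eq_L2sq f g : (forall t, 0 < t -> f t = g t) -> L2sq f = L2sq g.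
Proof.
by move=> fg; apply: eq_Rintegral => t; rewrite inE => /fg ->.
Qed.

Lemma eq_L2dot f f' g g' : (forall t, 0 < t -> f t = f' t) ->
  (forall t, 0 < t -> g t = g' t) -> L2dot f g = L2dot f' g'.
Proof.
move=> ff gg; apply: C_ext => /=; apply: eq_Rintegral => t;
by rewrite inE => t0; rewrite ff ?gg.
Qed.

Lemma L2sq_edd_perm s s' : upper s -> perm_eq s s' ->
  L2sq (edd s) = L2sq (edd s').
Proof. by move=> us p; apply: eq_L2sq => t t0; apply: edd_perm => //; exact: ltW. Qed.

(* The resolvent identity makes the product with [sqC (mu - nu)] bounded as well,
   uniformly in [mu] and [nu]. *)
Lemma L2sq_edd_pair (a : R) mu nu s : 0 < a -> a <= ImC mu -> a <= ImC nu ->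
  upper s -> s != [::] ->
  sqC (mu - nu) * L2sq (edd [:: mu, nu & s]) <= 4 / a ^+ 2 * L2sq (edd s) /\
  L2sq (edd [:: mu, nu & s]) <= a ^- 4 * L2sq (edd s).
Proof.
move=> a0 amu anu us s0.
have m0 : 0 < ImC mu by exact: lt_le_trans amu.
have n0 : 0 < ImC nu by exact: lt_le_trans anu.
have um : upper (mu :: s) by rewrite /= m0.
have un : upper (nu :: s) by rewrite /= n0.
have umn : upper [:: mu, nu & s] by rewrite /= m0.
have drop z s1 : a <= ImC z -> upper (z :: s1) -> s1 != [::] ->
    L2sq (edd (z :: s1)) <= a ^- 2 * L2sq (edd s1).
  move=> az u1 s10; rewrite mulrC ler_pdivlMr ?exprn_gt0// mulrC.
  apply: le_trans (L2sq_edd_cons u1 s10); rewrite ler_wpM2r ?L2sq_ge0//.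
  by rewrite ler_pXn2r// nnegrE ltW// (lt_le_trans a0).
have hm := drop _ _ amu um s0; have hn := drop _ _ anu un s0.
split.
  rewrite -L2sqZ; last exact: edd_ctame.
  rewrite (@eq_L2sq _ (fun t => edd (mu :: s) t - edd (nu :: s) t)); last first.
    by move=> t t0; rewrite edd_diff// ltW.
  apply: (le_trans (L2sq_sub_le (edd_ctame um) (edd_ctame un))).
  apply: le_trans (lerD (ler_wpM2l (ler0n _ 2) hm) (ler_wpM2l (ler0n _ 2) hn)) _.
  lra.
apply: (le_trans (drop _ _ amu umn isT)).
rewrite (_ : a ^- 4 = a ^- 2 * a ^- 2); last by rewrite -invfM -exprD.
by rewrite -mulrA ler_wpM2l// invr_ge0 exprn_ge0// ltW.
Qed.

End inner_product.

(** * Nearly parallel divided differences along a cluster *)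

Section nearly_parallel_step.
Context {R : realType}.
Local Notation C := (Cplx R).
Implicit Types (z w mu nu : C) (s p q : seq C) (f g : R -> C).

(** [c] bounds the squared cosine of the angle from below, without division or square root. *)
Definition nearly_parallel (c : R) f g :=
  c * (L2sq f * L2sq g) <= sqC (L2dot f g).

(* The norm of [edd s] rescaled by the modulus of its Laplace transform at the
   point [z] of the lower half-plane. *)
Definition relnorm z s : R := L2sq (edd s) * \prod_(nu <- s) sqC (z - nu).

Lemma sqC_add_le z w : sqC (z + w) <= 2 * sqC z + 2 * sqC w.
Proof.
rewrite /sqC !CE.
have := sqr_ge0 (ReC z - ReC w); have := sqr_ge0 (ImC z - ImC w); lra.
Qed.

Lemma sqCN z : sqC (- z) = sqC z.
Proof. by rewrite /sqC !CE !sqrrN. Qed.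

Lemma relnorm_perm z s s' : upper s -> perm_eq s s' -> relnorm z s = relnorm z s'.
Proof.
by move=> us ss; rewrite /relnorm (L2sq_edd_perm us ss) (perm_big _ ss).
Qed.

(** Only [nu] has to be close to [z]. The factor |z - mu|^2 is at most 2 B + 2 |mu - nu|^2, and both
    bounds of [L2sq_edd_pair] absorb it wherever [mu] lies. *)
Lemma relnorm_pair (a B : R) z mu nu s : 0 < a -> a <= ImC mu -> a <= ImC nu ->
  upper s -> s != [::] -> sqC (z - nu) <= B ->
  relnorm z [:: mu, nu & s] <= B * (8 / a ^+ 2 + 2 * B * a ^- 4) * relnorm z s.
Proof.
move=> a0 amu anu us s0 hB.
have B0 : 0 <= B by exact: le_trans (sqC_ge0 _) hB.
have [h1 h2] := L2sq_edd_pair a0 amu anu us s0.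
rewrite /relnorm !big_cons; set P := \prod_(_ <- s) _.
have P0 : 0 <= P by apply: prodr_ge0 => x _; exact: sqC_ge0.
set V := L2sq (edd [:: mu, nu & s]) in h1 h2 *; set V0 := L2sq (edd s) in h1 h2 *.
have V_ge0 : 0 <= V := L2sq_ge0 _.
have hA : sqC (z - mu) <= 2 * B + 2 * sqC (mu - nu).
  have -> : z - mu = (z - nu) + - (mu - nu) by ring.
  apply: (le_trans (sqC_add_le _ _)); rewrite sqCN lerD2r ler_wpM2l//.
have hVA : V * sqC (z - mu) <= (8 / a ^+ 2 + 2 * B * a ^- 4) * V0.
  apply: (le_trans (ler_wpM2l V_ge0 hA)).
  have := ler_wpM2l B0 h2; move: h1; lra.
rewrite (_ : V * _ = (V * sqC (z - mu)) * (sqC (z - nu) * P)); last by ring.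
rewrite (_ : B * _ * _ = ((8 / a ^+ 2 + 2 * B * a ^- 4) * V0) * (B * P)); last by ring.
apply: ler_pM => //.
- by rewrite mulr_ge0 ?sqC_ge0.
- by rewrite mulr_ge0 ?sqC_ge0.
- by rewrite ler_wpM2r.
Qed.

Lemma L2sq_edd1 nu : 0 < ImC nu -> L2sq (edd [:: nu]) = (2 * ImC nu)^-1.
Proof.
move=> nu0; rewrite -L2sq_ce//; apply: eq_L2sq => t t0.
by rewrite edd1// ltW.
Qed.

(** Each point of [p], of unknown location, is removed together with one of [q]; the extra point of
    [q] is the base case, with norm known explicitly. *)
Lemma relnorm_bound (a B : R) z p q : 0 < a -> size q = (size p).+1 ->
  (forall nu, nu \in p ++ q -> a <= ImC nu) ->
  (forall nu, nu \in q -> sqC (z - nu) <= B) ->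
  relnorm z (p ++ q) <=
  (B * (8 / a ^+ 2 + 2 * B * a ^- 4)) ^+ size p * (B / (2 * a)).
Proof.
move=> a0; elim: p q => [|mu p IH] [|nu q]//= [sq] hp hB.
  case: q sq hp hB => // _ hp hB.
  have anu : a <= ImC nu by apply: hp; rewrite mem_head.
  rewrite /relnorm big_seq1 expr0 mul1r L2sq_edd1; last exact: lt_le_trans anu.
  have n0 : 0 < ImC nu by exact: lt_le_trans anu.
  rewrite [leLHS]mulrC; apply: ler_pM.
  - exact: sqC_ge0.
  - by rewrite invr_ge0 mulr_ge0// ltW.
  - by apply: hB; rewrite mem_head.
  - by rewrite lef_pV2 ?posrE ?mulr_gt0// ler_wpM2l.
have up : upper (mu :: p ++ nu :: q).
  by apply/allP => x /hp /(lt_le_trans a0).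
have pm : perm_eq (mu :: p ++ nu :: q) [:: mu, nu & p ++ q].
  by rewrite perm_cons; exact: (permEl (perm_catCA p [:: nu] q)).
have hm x : x \in [:: mu, nu & p ++ q] -> a <= ImC x.
  by rewrite -(perm_mem pm); exact: hp.
rewrite (relnorm_perm _ up pm).
have hBnu : sqC (z - nu) <= B by apply: hB; rewrite mem_head.
have B0 : 0 <= B := le_trans (sqC_ge0 _) hBnu.
apply: (le_trans (@relnorm_pair a B z mu nu (p ++ q) _ _ _ _ _ _)) => //.
- by apply: hm; rewrite mem_head.
- by apply: hm; rewrite !inE eqxx orbT.
- by apply/allP => x xp; apply: (lt_le_trans a0); apply: hm; rewrite !inE xp !orbT.
- by rewrite -size_eq0 size_cat sq addnS.
rewrite [_ ^+ (size p).+1]exprS -[leRHS]mulrA ler_wpM2l//.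
  rewrite mulr_ge0// addr_ge0// ?divr_ge0 ?mulr_ge0 ?invr_ge0 ?exprn_ge0//; exact: ltW.
apply: IH => //.
- by move=> x xp; apply: hm; rewrite !inE xp !orbT.
- by move=> x xq; apply: hB; rewrite inE xq orbT.
Qed.

(** Without near parallelism, [edd_dot_ge] gives (Im nu)^2 ||[nu, s]||^2 <= c ||[s]||^2, while the
    new factor |z - nu|^2 is at most (Im nu)^2 / rho. *)
Lemma relnorm_step (c rho : R) z nu s : 0 < rho -> upper (nu :: s) -> s != [::] ->
  rho * sqC (z - nu) <= ImC nu ^+ 2 -> ~ nearly_parallel c (edd s) (edd (nu :: s)) ->
  relnorm z (nu :: s) <= c / rho * relnorm z s.
Proof.
move=> rho0 us s0 hr /negP; rewrite -ltNge => hc.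
have u0 := L2sq_edd_gt0 us isT.
have hV : ImC nu ^+ 2 * L2sq (edd (nu :: s)) <= c * L2sq (edd s).
  have := le_trans (edd_dot_ge us s0) (ltW hc).
  by rewrite [L2sq (edd (nu :: s)) ^+ 2]expr2 !mulrA ler_pM2r.
rewrite /relnorm big_cons; set P := \prod_(_ <- s) _.
have P0 : 0 <= P by apply: prodr_ge0 => x _; exact: sqC_ge0.
rewrite mulrA [leRHS]mulrA ler_wpM2r// mulrAC ler_pdivlMr// -mulrA mulrC.
by rewrite [_ * rho]mulrC; apply: le_trans (ler_wpM2r (ltW u0) hr) hV.
Qed.

(** The size also governs the diameter, so that one number measures both length and tightness. *)
Definition clustered (q : seq C) := forall z w, z \in q -> w \in q ->
  absC (z - w) < (size q).+1%:R^-1.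

Lemma geometric_small (k e A : R) : 0 <= k < 1 -> 0 < e -> exists n, forall m,
  (n <= m)%N -> k ^+ m * A < e.
Proof.
move=> /andP[k0 k1] e0.
have h : (k ^+ m * A) @[m --> \oo] --> (0 : R).
  rewrite -[X in _ --> X](mul0r A); apply: cvgM; last exact: cvg_cst.
  by apply: cvg_expr; rewrite ger0_norm.
move/cvgrPdist_lt: h => /(_ _ e0) [n _ hn]; exists n => m nm.
by have := hn m nm; rewrite /= sub0r normrN; apply: le_lt_trans; exact: ler_norm.
Qed.

Lemma cluster_step (a b c : R) K : 0 < a -> a <= b -> 0 < c < 1 ->
  exists M, forall p q, size p = K -> (M <= size q)%N ->
    (forall nu, nu \in p ++ q -> a <= ImC nu <= b) -> clustered q ->
    exists n, (n.+1 < size (p ++ q))%N /\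
      nearly_parallel c (edd (take n.+1 (p ++ q))) (edd (take n.+2 (p ++ q))).
Proof.
move=> a0 ab /andP[c0 c1].
(* With this margin [rho] = 1 - 6 th lies strictly between c and 1 and satisfies rho (1 + 2 th)^2 <=
   (1 - th)^2. *)
pose th := (1 - c) / 12; have th0 : 0 < th by rewrite divr_gt0// subr_gt0.
have th1 : th < 1 / 12 by rewrite /th; lra.
pose d := th * a; have d0 : 0 < d by rewrite mulr_gt0.
pose rho := (1 + c) / 2.
have rho0 : 0 < rho by rewrite /rho; lra.
have k01 : 0 <= c / rho < 1.
  by rewrite divr_ge0 ?ltW//= ltr_pdivrMr// mul1r /rho; lra.
pose B := ((1 + 2 * th) * b) ^+ 2.
pose A := (B * (8 / a ^+ 2 + 2 * B * a ^- 4)) ^+ K * (B / (2 * a)).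
have d20 : 0 < 2 * d by rewrite mulr_gt0.
have [n1 hn1] := geometric_small A k01 d20.
have [n2 hn2] : exists n2, forall m, (n2 <= m)%N -> m.+1%:R^-1 < d.
  have [n2 hn2] := @ltr_add_invr R 0 d d0.
  exists n2 => m nm; move: hn2; rewrite add0r; apply: le_lt_trans.
  by rewrite lef_pV2 ?posrE ?ltr0n// ler_nat.
(* [n2] makes the diameter of the cluster less than [d]. Of its points, K + 1 serve to remove [p],
   and at least [n1] remain for the geometric decay. *)
exists (maxn n2 (n1 + K.+1)) => p q sp; rewrite geq_max => /andP[n2q n1q] hst hcl.
apply: contrapT => hno.
have q0 : (0 < size q)%N by apply: leq_trans n1q; rewrite addnS.
pose nu0 := nth 0 q 0; have nu0q : nu0 \in q by exact: mem_nth.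
pose Y := ImC nu0.
have hY : a <= Y <= b by apply: hst; rewrite mem_cat nu0q orbT.
have [aY Yb] := andP hY.
have Y0 : 0 < Y by exact: lt_le_trans aY.
have Z0 : 0 <= (1 + 2 * th) * Y by apply: mulr_ge0; [lra|exact: ltW].
have Z1 : 0 <= (1 - th) * Y by apply: mulr_ge0; [lra|exact: ltW].
have dY : d <= th * Y by rewrite ler_wpM2l// ltW.
(* The Laplace transform is evaluated at conj w, at depth [d] below the real axis under the first
   cluster point. All cluster points are within Y + 2d <= (1 + 2 th) Y of it and have imaginary part
   at least (1 - th) Y. *)
pose w : C := Complex (ReC nu0) d.
have w0 : 0 < ImC w by [].
have hd nu : nu \in q -> absC (nu - nu0) < d.
  by move=> nuq; apply: lt_trans (hn2 _ n2q); exact: hcl.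
have ImLow nu : nu \in q -> (1 - th) * Y <= ImC nu.
  move=> /hd nud; have := le_lt_trans (ler_ImC _) nud.
  by rewrite !CE ltr_norml -/Y => /andP[]; move: dY; lra.
have AUp nu : nu \in q -> sqC (conjC w - nu) <= ((1 + 2 * th) * Y) ^+ 2.
  move=> /hd nud.
  have h1 : absC (conjC w - nu0) = Y + d.
    rewrite absC_sqrt /sqC !CE /= subrr expr0n add0r -opprD sqrrN sqrtr_sqr.
    by rewrite -/Y ger0_norm 1?addrC// addr_ge0 ?ltW// (lt_le_trans a0).
  rewrite -absC_sq ler_pXn2r ?nnegrE ?absC_ge0 ?Z0//.
  have -> : conjC w - nu = (conjC w - nu0) - (nu - nu0) by ring.
  apply: (le_trans (absCD _ _)); rewrite h1.
  have -> : absC (- (nu - nu0)) = absC (nu - nu0) by rewrite !absC_sqrt sqCN.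
  move: dY nud; lra.
have hrho nu : nu \in q -> rho * sqC (conjC w - nu) <= ImC nu ^+ 2.
  move=> nuq; apply: (@le_trans _ _ (((1 - th) * Y) ^+ 2)); last first.
    by rewrite ler_pXn2r ?nnegrE ?ImLow ?Z1// (le_trans Z1)// ImLow.
  apply: (le_trans (ler_wpM2l (ltW rho0) (AUp _ nuq))).
  rewrite !exprMn mulrA ler_wpM2r ?sqr_ge0//.
  have -> : rho = 1 - 6 * th by rewrite /rho /th; field.
  rewrite -subr_ge0.
  have -> : (1 - th) ^+ 2 - (1 - 6 * th) * (1 + 2 * th) ^+ 2 =
     th ^+ 2 * (21 + 24 * th) by ring.
  by rewrite mulr_ge0 ?sqr_ge0//; lra.
have upq : upper (p ++ q).
  by apply/allP => x /hst /andP[/(lt_le_trans a0)].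
pose W l := relnorm (conjC w) (take l (p ++ q)).
have Wstep l : (K <= l)%N -> (0 < l)%N -> (l < size (p ++ q))%N ->
    W l.+1 <= c / rho * W l.
  move=> Kl l0 ls.
  have ut m : upper (take m (p ++ q)).
    by apply/allP => x /mem_take; move: x; exact/allP.
  pose nu := nth 0 (p ++ q) l.
  have nuq : nu \in q.
    rewrite /nu nth_cat sp ltnNge Kl /= mem_nth//.
    by move: ls; rewrite size_cat sp -ltn_subLR.
  have pr : perm_eq (take l.+1 (p ++ q)) (nu :: take l (p ++ q)).
    by rewrite (take_nth 0)// perm_rcons.
  rewrite /W (relnorm_perm _ (ut _) pr).
  have un : upper (nu :: take l (p ++ q)) by rewrite -(upper_perm pr).
  apply: relnorm_step => //.
  - by rewrite -size_eq0 size_take ls -lt0n.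
  - exact: hrho.
  (* The prefixes compared have lengths l and l + 1, that is n + 1 and n + 2 for n = l - 1. *)
  - move=> hnp; apply: hno; exists l.-1; rewrite prednK//; split=> //.
    move: hnp; rewrite /nearly_parallel -(L2sq_edd_perm (ut _) pr).
    suff -> : L2dot (edd (take l (p ++ q))) (edd (take l.+1 (p ++ q))) =
      L2dot (edd (take l (p ++ q))) (edd (nu :: take l (p ++ q))) by [].
    apply: eq_L2dot => // t t0; apply: edd_perm => //; last exact: ltW.
(* The first 2K + 1 points are [p] and K + 1 cluster points, bounded by [A]; each further point
   contributes a factor c / rho. *)
have sz : size (p ++ q) = ((2 * K).+1 + (size q - K.+1))%N.
  by rewrite size_cat sp; move: n1q; clear; lia.
have Wj j : (j <= size q - K.+1)%N ->
    W ((2 * K).+1 + j)%N <= (c / rho) ^+ j * W (2 * K).+1%N.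
  elim: j => [|j IH] jq; first by rewrite addn0 expr0 mul1r.
  rewrite addnS exprS -mulrA; apply: (le_trans (Wstep _ _ _ _)).
  - by clear; lia.
  - by rewrite addSn.
  - by rewrite sz ltn_add2l.
  - by rewrite ler_wpM2l ?(andP k01).1// IH// ltnW.
have WK : W (2 * K).+1%N <= A.
  have Kq : (K.+1 <= size q)%N by apply: leq_trans n1q; exact: leq_addl.
  have -> : W (2 * K).+1%N = relnorm (conjC w) (p ++ take K.+1 q).
    rewrite /W take_cat sp ltnNge mul2n -addnn -addnS leq_addr /=.
    by rewrite addnC addnK.
  rewrite /A -sp; apply: relnorm_bound => //.
  - by rewrite size_take_min sp; exact/minn_idPl.
  - move=> x xpq; suff : x \in p ++ q by move=> /hst /andP[].
    by move: xpq; rewrite !mem_cat => /orP[->//|/mem_take ->]; rewrite orbT.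
  - move=> x /mem_take /AUp xA; apply: (le_trans xA).
    have Zb : (1 + 2 * th) * Y <= (1 + 2 * th) * b by apply: ler_wpM2l => //; lra.
    by rewrite ler_pXn2r ?nnegrE ?(le_trans Z0 Zb).
have s0 : p ++ q != [::] by rewrite -size_eq0 size_cat -lt0n addn_gt0 q0 orbT.
(* The Laplace transform bound, which the geometric decay contradicts. *)
have low : 2 * d <= W (size (p ++ q)).
  by rewrite /W take_size; exact: (L2sq_edd_ge w0 upq s0).
have := hn1 (size q - K.+1)%N; rewrite leq_subRL; last first.
  by apply: leq_trans n1q; exact: leq_addl.
rewrite addnC n1q => /(_ isT); apply/negP; rewrite -leNgt.
apply: (le_trans low); rewrite sz; apply: (le_trans (Wj _ (leqnn _))).
by rewrite ler_wpM2l// exprn_ge0// (andP k01).1.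
Qed.

End nearly_parallel_step.

(** * Clusters and numberings *)

Section greedy_colouring.
Variables (r : rel nat) (N : nat).

(** Holds the colours of 0, ..., n - 1. The next colour is the least one that no earlier neighbour
    has; the value [N] would mean that none is free. *)
Fixpoint greedy_colours (n : nat) : seq nat :=
  if n is m.+1 then
    let s := greedy_colours m in
    rcons s (find (fun k => k \notin [seq nth 0 s i | i <- iota 0 m & r m i])
                  (iota 0 N))
  else [::].

Definition greedy_colour n := nth 0 (greedy_colours n.+1) n.

Lemma size_greedy_colours n : size (greedy_colours n) = n.
Proof. by elim: n => //= n IH; rewrite size_rcons IH. Qed.

Lemma nth_greedy_colours n i : (i < n)%N ->
  nth 0 (greedy_colours n) i = greedy_colour i.
Proof.
elim: n => // n IH; rewrite ltnS leq_eqVlt => /predU1P[->//|lt_in].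
by rewrite /= nth_rcons size_greedy_colours lt_in IH.
Qed.

Lemma greedy_colouring :
  (forall n, (size [seq i <- iota 0 n | r n i] < N)%N) ->
  (forall n, greedy_colour n < N)%N /\
  forall n i, (i < n)%N -> r n i -> greedy_colour i <> greedy_colour n.
Proof.
move=> degN.
have H n : has (fun k => k \notin
    [seq nth 0 (greedy_colours n) i | i <- iota 0 n & r n i]) (iota 0 N).
  apply: contraLR (degN n); rewrite -all_predC -leqNgt => /allP all_used.
  rewrite -(size_map (nth 0 (greedy_colours n))) -[leqLHS](size_iota 0 N).
  apply: uniq_leq_size; first exact: iota_uniq.
  by move=> k /all_used /=; rewrite negbK.
have E n : greedy_colour n = find (fun k => k \notin
    [seq nth 0 (greedy_colours n) i | i <- iota 0 n & r n i]) (iota 0 N).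
  by rewrite /greedy_colour /= nth_rcons size_greedy_colours ltnn eqxx.
have ltN n : (greedy_colour n < N)%N.
  by have := H n; rewrite has_find size_iota -E.
split=> // n i lt_in rni eq_c.
have := nth_find 0 (H n); rewrite -E nth_iota// add0n -eq_c.
rewrite -(nth_greedy_colours lt_in) => /negP; apply; apply: map_f.
by rewrite mem_filter rni mem_iota.
Qed.

End greedy_colouring.

(** * Clusters in components, and numberings from chains of lists *)

Section clusters.
Context {R : realType}.
Local Notation C := (Cplx R).
Implicit Types (lambda : int -> C) (J A : set int) (q l : seq int).

Definition has_cluster lambda A m := exists q,
  [/\ size q = m, uniq q, forall i, i \in q -> A i & clustered (map lambda q)].

Lemma clustered_sub (p q : seq C) : {subset p <= q} -> (size p <= size q)%N ->
  clustered q -> clustered p.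
Proof.
move=> pq spq cq z w zp wp; apply: lt_le_trans (cq _ _ (pq _ zp) (pq _ wp)) _.
by rewrite lef_pV2 ?posrE ?ltr0n// ler_nat ltnS.
Qed.

Lemma has_cluster_le lambda A m n : (m <= n)%N ->
  has_cluster lambda A n -> has_cluster lambda A m.
Proof.
move=> mn [q [sq uq qA cq]]; exists (take m q); split.
- by rewrite size_take sq; case: ltngtP mn.
- exact: take_uniq.
- by move=> i /mem_take; exact: qA.
- apply: clustered_sub cq; first by move=> z; rewrite map_take; exact: mem_take.
  by rewrite !size_map size_take_min geq_minr.
Qed.

(** At most [size l] indices are deleted, and for fewer points the diameter condition is weaker. *)
Lemma has_cluster_avoid lambda A m l : has_cluster lambda A (m + size l) ->
  exists q, [/\ (m <= size q)%N, uniq q,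
    forall i, i \in q -> A i /\ i \notin l & clustered (map lambda q)].
Proof.
move=> [q [sq uq qA cq]]; exists [seq i <- q | i \notin l]; split.
- rewrite size_filter -(leq_add2r (size l)) -sq -(count_predC (mem l) q).
  rewrite addnC leq_add2l -size_filter; apply: uniq_leq_size.
    exact: filter_uniq.
  by move=> i; rewrite mem_filter => /andP[].
- exact: filter_uniq.
- by move=> i; rewrite mem_filter => /andP[il /qA].
- apply: clustered_sub cq; last by rewrite !size_map size_filter count_size.
  by move=> _ /mapP[i + ->]; rewrite mem_filter => /andP[_ iq]; exact: map_f.
Qed.

(* The graph joining the indices of points at distance less than half the
   diameter of a cluster has bounded degree if there is no large cluster, so
   that it can be coloured with finitely many colours. *)
Lemma clusters_of_all_sizes lambda J m :
  ~ relatively_uniformly_discrete J lambda -> has_cluster lambda J m.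
Proof.
move=> hn; apply: contrapT => hno; apply: hn.
pose d : R := m.+1%:R^-1 / 2.
have d0 : 0 < d by rewrite divr_gt0// invr_gt0 ltr0n.
(* Integer indices are transported to natural numbers by [pickle], which gives the order for the
   greedy colouring. *)
pose r : rel nat := fun n i =>
  if (pickle_inv n : option int, pickle_inv i : option int) is (Some x, Some y)
  then `[< J y >] && (absC (lambda x - lambda y) < d) else false.
have absCC z w : absC (z - w : C) = absC (w - z).
  by rewrite -opprB !absC_sqrt sqCN.
have deg n : (size [seq i <- iota 0 n | r n i] < m)%N.
  rewrite ltnNge; apply/negP => hm; apply: hno.
  set L := [seq i <- iota 0 n | r n i] in hm.
  have Lr i : i \in L -> r n i by rewrite mem_filter => /andP[].
  pose q : seq int := pmap pickle_inv L.
  have sq : size q = size L.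
    rewrite size_pmap -[RHS](count_predT L); apply/eq_in_count => i /Lr.
    by rewrite /r; case: (pickle_inv n) => // x; case: (pickle_inv i).
  have uq : uniq q.
    by apply: (pmap_uniq (@pickle_invK _)); rewrite filter_uniq// iota_uniq.
  have hq y : y \in q -> J y /\ exists2 x, pickle_inv n = Some x &
      absC (lambda x - lambda y) < d.
    rewrite mem_pmap => /mapP[i /Lr]; rewrite /r.
    case: (pickle_inv n) => // x; case: (pickle_inv i) => // y' /andP[/asboolP Jy h].
    by move=> [->]; split=> //; exists x.
  apply: (@has_cluster_le _ _ _ (size (take m q))).
    by rewrite size_take sq; case: ltngtP hm => // ->.
  exists (take m q); split=> //.
  - exact: take_uniq.
  - by move=> i /mem_take /hq[].
  - move=> _ _ /mapP[i /mem_take iq ->] /mapP[j /mem_take jq ->].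
    have [_ [x Ex hi]] := hq _ iq; have [_ [y Ey hj]] := hq _ jq.
    move: Ey; rewrite Ex => -[xy]; subst y.
    have -> : lambda i - lambda j = (lambda i - lambda x) + (lambda x - lambda j).
      by ring.
    apply: (le_lt_trans (absCD _ _)); rewrite absCC.
    apply: (@lt_le_trans _ _ m.+1%:R^-1).
      by rewrite [ltRHS](splitr _); exact: ltrD.
    rewrite lef_pV2 ?posrE ?ltr0n// ler_nat ltnS size_map size_take_min.
    exact: geq_minl.
have [cN cr] := greedy_colouring deg.
pose c (x : int) : nat := greedy_colour r m (pickle x).
exists m, (fun i : 'I_m => [set x | J x /\ c x = i :> nat]); split.
- apply/seteqP; split; first by move=> x [i _ []].
  by move=> x Jx; exists (Ordinal (cN (pickle x))).
- move=> i j _ _ [x [[_ xi] [_ xj]]]; apply/val_inj.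
  by rewrite /= -xi -xj.
- move=> i; apply: (@lt_le_trans _ _ d%:E); first by rewrite lte_fin.
  apply: le_ereal_inf_tmp => _ [k [n [[Jk ck] [Jn cn] kn ->]]].
  rewrite lee_fin leNgt; apply/negP => hd.
  have rkn (x y : int) : J y -> absC (lambda x - lambda y) < d -> r (pickle x) (pickle y).
    move=> Jy h; rewrite /r !pickleK_inv h andbT; exact/asboolP.
  have : pickle k != pickle n.
    by apply/eqP => /(pcan_inj (@pickleK int)).
  rewrite neq_ltn => /orP[lt|lt].
    apply: (cr _ _ lt); last by rewrite -/(c _) ck -cn.
    by apply: rkn => //; rewrite absCC.
  apply: (cr _ _ lt); last by rewrite -/(c _) cn -ck.
  exact: rkn.
Qed.

Lemma ofR_continuous : continuous (@ofR R).
Proof.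
move=> t; apply/cvgrPdist_lt => e e0.
have re0 : 0 < complex.Re e by move: e0; rewrite ltcE => /andP[].
have ie0 : complex.Im e = 0 by move: e0; rewrite ltcE => /andP[/eqP].
near=> u.
have -> : ofR t - ofR u = ofR (t - u).
  by apply: C_ext; rewrite !CE ?subrr.
rewrite -absC_norm absC_sqrt sqC_ofR sqrtr_sqr ltcE ie0 eqxx /=.
near: u; move: (complex.Re e) re0 => d d0.
have /cvgrPdist_lt := @cvg_id R (nbhs t); exact.
Unshelve. all: by end_near.
Qed.

(** The segment from the centre to [z] is connected and stays in the disk. *)
Lemma component_disk lambda J (r : R) k (z : C) : J k -> absC (z - lambda k) < r ->
  connected_component (disk_union J lambda r) (lambda k) z.
Proof.
move=> Jk zr; pose g (u : R) : C := lambda k + ofR u * (z - lambda k).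
have gc : continuous g.
  move=> u; apply: cvgD; first exact: cvg_cst.
  by apply: cvgM; [exact: ofR_continuous|exact: cvg_cst].
exists (g @` `[0, 1]).
  split.
  - exists 0; first by rewrite /= in_itv /= lexx ler01.
    rewrite /g (_ : ofR 0 = 0); last exact: C_ext.
    by rewrite mul0r addr0.
  - move=> _ [u /= + <-]; rewrite in_itv /= => /andP[u0 u1].
    exists k => //; rewrite /disk /= /g addrC addKr absCM.
    rewrite absC_sqrt sqC_ofR sqrtr_sqr ger0_norm//.
    by apply: le_lt_trans zr; rewrite -[leRHS]mul1r ler_wpM2r// absC_ge0.
  - apply: connected_continuous_connected; first exact: segment_connected.
    exact: continuous_subspaceT.
exists 1; first by rewrite /= in_itv /= ler01 lexx.
rewrite /g (_ : ofR 1 = 1); last exact: C_ext.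
by rewrite mul1r addrC subrK.
Qed.

(** The whole cluster lies in the disk of radius [r] about its first point. *)
Lemma cluster_in_component lambda J (r : R) m : (0 < m)%N -> m.+1%:R^-1 <= r ->
  has_cluster lambda J m -> exists2 G, components J lambda r G &
    has_cluster lambda (group J lambda G) m.
Proof.
move=> m0 mr [q [sq uq qJ cq]].
have r0 : 0 < r by apply: lt_le_trans mr; rewrite invr_gt0 ltr0n.
case: q sq uq qJ cq => [|k q] sq uq qJ cq; first by rewrite -sq in m0.
have Jk : J k by apply: qJ; rewrite mem_head.
exists (connected_component (disk_union J lambda r) (lambda k)).
  exists (lambda k) => //; exists k => //.
  by rewrite /disk /= subrr absC_sqrt sqC0 sqrtr0.
exists (k :: q); split=> // i iq; split; first exact: qJ.
apply: component_disk => //; apply: lt_le_trans mr; rewrite -sq -(size_map lambda).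
by apply: cq; apply: map_f; rewrite // mem_head.
Qed.

Definition numbering_prefix (D : set nat) (nu : nat -> int) l :=
  forall i, (i < size l)%N -> D i /\ nu i = nth 0 l i.

(** Lists are extended forever: stage k first achieves [Q k], then appends the element of [A] with
    code k if it is still missing. The limit is therefore onto [A], and its domain is the set of
    positions reached, finite or not. *)
Lemma chain_numbering A (Q : nat -> seq int -> Prop) l0 :
  uniq l0 -> (forall i, i \in l0 -> A i) ->
  (forall k l, uniq l -> (forall i, i \in l -> A i) -> exists l2,
     [/\ uniq (l ++ l2), forall i, i \in l2 -> A i & Q k (l ++ l2)]) ->
  exists D nu, [/\ is_numbering A D nu, numbering_prefix D nu l0 &
    forall k, exists2 l, Q k l & numbering_prefix D nu l].
Proof.
move=> ul0 l0A hstep.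
pose valid l := uniq l /\ forall i, i \in l -> A i.
(* Validity is a premise under the existential, so that choice yields a total step function. *)
have ext (kl : nat * seq int) : exists l', valid kl.2 ->
    [/\ valid l', prefix kl.2 l', forall x : int, pickle x = kl.1 -> A x -> x \in l' &
      exists2 l'', Q kl.1 l'' & prefix l'' l'].
  case: kl => k l /=; have [[ul lA]|] := pselect (valid l); last by exists l.
  have [l2 [ul2 l2A Ql2]] := hstep k l ul lA.
  pose l1 := l ++ l2.
  have l1A i : i \in l1 -> A i by rewrite mem_cat => /orP[/lA|/l2A].
  have [[x [px Ax xl]]|hno] :=
    pselect (exists x : int, [/\ pickle x = k, A x & x \notin l1]).
    exists (l1 ++ [:: x]) => _; split.
    - split; first by rewrite cat_uniq ul2 /= orbF andbT xl.
      by move=> i; rewrite mem_cat inE => /orP[/l1A|/eqP->].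
    - by rewrite /l1 -catA prefix_prefix.
    - move=> y py _; rewrite (_ : y = x) ?mem_cat ?mem_head ?orbT//.
      by apply: (pcan_inj (@pickleK int)); rewrite px py.
    - by exists l1 => //; exact: prefix_prefix.
  exists l1 => _; split=> //.
  - exact: prefix_prefix.
  - by move=> x px Ax; apply: contrapT => /negP xl; apply: hno; exists x.
  - by exists l1 => //; exact: prefix_refl.
have [step hs] := choice ext.
pose L := fix L k := if k is k'.+1 then step (k', L k') else l0.
have vL k : valid (L k).
  by elim: k => [|k IH] //=; case: (hs (k, L k)).
have sL k : [/\ valid (L k.+1), prefix (L k) (L k.+1),
    forall x : int, pickle x = k -> A x -> x \in L k.+1 &
    exists2 l, Q k l & prefix l (L k.+1)].
  exact: (hs (k, L k) (vL k)).
have pL j k : (j <= k)%N -> prefix (L j) (L k).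
  elim: k => [|k IH]; first by rewrite leqn0 => /eqP ->; exact: prefix_refl.
  rewrite leq_eqVlt => /predU1P[->|/IH h]; first exact: prefix_refl.
  by apply: prefix_trans h _; case: (sL k).
have pn (s s' : seq int) i : prefix s s' -> (i < size s)%N ->
    (i < size s')%N /\ nth 0 s' i = nth 0 s i.
  move=> /prefixP[s2 ->] h; rewrite nth_cat h size_cat; split=> //.
  exact: ltn_addr.
have agree j k i : (i < size (L j))%N -> (i < size (L k))%N ->
    nth 0 (L j) i = nth 0 (L k) i.
  move=> hj hk; have [jk|kj] := leqP j k.
    by have [_ ->] := pn _ _ _ (pL _ _ jk) hj.
  by have [_ ->] := pn _ _ _ (pL _ _ (ltnW kj)) hk.
have exnu n : exists x, forall k, (n < size (L k))%N -> nth 0 (L k) n = x.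
  have [[k hk]|hno] := pselect (exists k, (n < size (L k))%N).
    by exists (nth 0 (L k) n) => j hj; exact: agree.
  by exists 0 => k hk; exfalso; apply: hno; exists k.
have [nu hnu] := choice exnu.
pose D := [set n | exists k, (n < size (L k))%N].
have npre k l : prefix l (L k) -> numbering_prefix D nu l.
  move=> pl i il; have [ik e] := pn _ _ _ pl il.
  by split; [exists k|rewrite -(hnu _ _ ik)].
exists D, nu; split.
- split; first by move=> j k jk [n kn]; exists n; exact: leq_ltn_trans kn.
  split.
  + move=> n [k nk]; rewrite -(hnu _ _ nk); apply: (vL k).2; exact: mem_nth.
  + move=> i j; rewrite !inE => -[k ik] [k' jk'].
    have ik2 := (pn _ _ _ (pL _ _ (leq_maxl k k')) ik).1.
    have jk2 := (pn _ _ _ (pL _ _ (leq_maxr k k')) jk').1.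
    rewrite -(hnu _ _ ik2) -(hnu _ _ jk2) => /eqP.
    by rewrite nth_uniq ?(vL _).1// => /eqP.
  + move=> x Ax; have [_ _ h _] := sL (pickle x).
    have {}h := h x erefl Ax; exists (index x (L (pickle x).+1)).
      by exists (pickle x).+1; rewrite index_mem.
    by rewrite -(hnu _ (pickle x).+1) ?index_mem// nth_index.
- exact: (npre 0%N _ (prefix_refl _)).
- move=> k; have [_ _ _ [l Ql pl]] := sL k.
  by exists l => //; exact: (npre k.+1).
Qed.

End clusters.

(** * Numberings adapted to the clusters of a group *)

Section numbering.
Context {R : realType}.
Local Notation C := (Cplx R).
Implicit Types (J A : set int) (q l : seq int).
Variables (lambda : int -> C) (J : set int) (alpha beta : R).
Hypotheses (alpha0 : 0 < alpha) (alphabeta : alpha <= beta).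
Hypothesis strip : forall n, J n -> alpha <= ImC (lambda n) <= beta.

(** Thresholds for the squared cosine, tending to 1; the shift by 2 keeps the one for k = 0
    positive. *)
Definition near_one (k : nat) : R := 1 - k.+2%:R^-1.

Lemma near_one_itv k : 0 < near_one k < 1.
Proof.
have h : (0 : R) < k.+2%:R^-1 by rewrite invr_gt0 ltr0n.
rewrite /near_one subr_gt0 invf_lt1 ?ltr0n// ltr1n/=.
by rewrite ltrBlDr ltrDl.
Qed.

Definition has_step (k : nat) l := exists n, (n.+1 < size l)%N /\
  nearly_parallel (near_one k) (edd (take n.+1 (map lambda l)))
                               (edd (take n.+2 (map lambda l))).

(** [M] comes before [A] because the component for a given k is found afterwards, from a cluster of
    size at least [M k]. *)
Lemma good_numbering : exists M : nat -> nat, forall A, A `<=` J ->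
  exists D nu, is_numbering A D nu /\
    forall k, has_cluster lambda A (M k) ->
      exists2 l, has_step k l & numbering_prefix D nu l.
Proof.
have /choice[M hM] (kK : nat * nat) :=
  @cluster_step R alpha beta (near_one kK.1) kK.2 alpha0 alphabeta (near_one_itv _).
have stepM k p q : (M (k, size p) <= size q)%N ->
    (forall i, i \in p ++ q -> J i) -> clustered (map lambda q) ->
    has_step k (p ++ q).
  move=> hq pqJ cq.
  have [|||n [hn np]] := hM (k, size p) (map lambda p) (map lambda q) _ _ _ cq.
  - by rewrite size_map.
  - by rewrite size_map.
  - by move=> z; rewrite -map_cat => /mapP[i /pqJ Ji ->]; exact: strip.
  - by exists n; move: hn np; rewrite -map_cat size_map.
(* The second component 0 is for a largest cluster placed first, with no preceding points. *)
exists (fun k => M (k, 0%N)) => A AJ.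
have [bad|] := pselect (forall m, has_cluster lambda A m).
  have [||k l ul lA|D [nu [hD _ hQ]]] := @chain_numbering A has_step [::] => //.
    (* The extra [size l] makes up for the discarded indices, those already numbered. *)
    have [q [sq uq qA cq]] := has_cluster_avoid (bad (M (k, size l) + size l)%N).
    exists q; split.
    - rewrite cat_uniq ul uq andbT /=; apply/hasPn => i /qA[_].
      exact.
    - by move=> i /qA[].
    - apply: stepM => // i; rewrite mem_cat => /orP[/lA|/qA[]];
      by move=> /AJ.
  by exists D, nu; split=> // k _; exact: hQ.
move=> /existsNP[m0 hm0].
have P0 : exists m, `[< has_cluster lambda A m >].
  by exists 0%N; apply/asboolP; exists [::].
have Pm m : `[< has_cluster lambda A m >] -> (m <= m0)%N.
  move=> /asboolP h; rewrite leqNgt; apply/negP => /ltnW lt; apply: hm0.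
  exact: has_cluster_le lt h.
case: (ex_maxnP P0 Pm) => m /asboolP[q [sq uq qA cq]] mmax.
(* The chain only completes the numbering: the initial cluster, being largest, serves every k whose
   required size occurs in [A]. *)
have [//|//|k l ul lA|D [nu [hD hl _]]] := @chain_numbering A (fun _ _ => True) q.
  by exists [::]; rewrite cats0.
exists D, nu; split=> // k hk; exists q => //.
apply: (stepM k [::] q) => //.
  by rewrite sq; apply: mmax; apply/asboolP.
by move=> i /qA /AJ.
Qed.

End numbering.

(** * Angles and uniform minimality *)

Section angles_and_distances.
Context {R : realType}.
Local Notation C := (Cplx R).
Implicit Types (z : C) (f g h : R -> C).

Lemma L2normE f : L2norm f = Num.sqrt (L2sq f).
Proof.
by congr Num.sqrt; apply: eq_Rintegral => t _; rewrite absC_sq.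
Qed.

(** [gdd] is identified with [edd] for t >= 0 only. *)
Definition tame_on_halfline f := exists2 h, ctame h & forall t, 0 < t -> f t = h t.

Lemma tame_on_halfline_L2 f : tame_on_halfline f -> L2 f.
Proof.
move=> [h th fh]; have [h1 h2] := th; split.
- apply: (eq_measurable_fun (fun t => ReC (h t))); last exact: tame_measurable.
  by move=> t; rewrite inE => /fh ->.
- apply: (eq_measurable_fun (fun t => ImC (h t))); last exact: tame_measurable.
  by move=> t; rewrite inE => /fh ->.
- suff -> : (\int[lebesgue_measure]_(t in halfline) (absC (f t) ^+ 2)%:E =
      \int[lebesgue_measure]_(t in halfline) (EFin \o (fun t => sqC (h t))) t)%E.
    apply: integrable_lty; first exact: measurable_halfline.
    by apply: tame_integrable; exact: ctame_sqC.
  by apply: eq_integral => t; rewrite inE => /fh ->; rewrite absC_sq.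
Qed.

Lemma tame_on_halflineZ z f : tame_on_halfline f ->
  tame_on_halfline (fun t => z * f t).
Proof.
move=> [h th fh]; exists (fun t => z * h t); first exact: ctameZ.
by move=> t /fh ->.
Qed.

(** The cosine v of the angle satisfies v^2 >= c >= c^2, so v >= c > cos (min e pi). The minimum
    with pi keeps to the interval where the cosine decreases. *)
Lemma nearly_parallel_angle (c e : R) f g :
  tame_on_halfline f -> tame_on_halfline g -> 0 < L2sq f -> 0 < L2sq g ->
  0 <= c <= 1 -> 0 < e -> cos (Num.min e pi) < c ->
  nearly_parallel c f g -> L2angle f g < e.
Proof.
move=> [f' tf ff] [g' tg gg] f0 g0 /andP[c0 c1] e0 ec hc.
rewrite /L2angle !L2normE -sqrtrM ?ltW//.
set v := absC _ / _.
have P0 : 0 < L2sq f * L2sq g by exact: mulr_gt0.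
have v2 : v ^+ 2 = sqC (L2dot f g) / (L2sq f * L2sq g).
  by rewrite /v exprMn absC_sq exprVn sqr_sqrtr// ltW.
have v0 : 0 <= v by rewrite divr_ge0 ?absC_ge0 ?sqrtr_ge0.
have v1 : v <= 1.
  rewrite -(@ler_pXn2r _ 2)// ?nnegrE// v2 expr1n ler_pdivrMr// mul1r.
  rewrite (eq_L2dot ff gg) (eq_L2sq ff) (eq_L2sq gg).
  by apply: cauchy_schwarz => //; rewrite -(eq_L2sq gg).
have cv : c <= v.
  rewrite -(@ler_pXn2r _ 2)// ?nnegrE// v2 ler_pdivlMr//.
  by apply: le_trans hc; apply: ler_wpM2r; [exact: ltW|rewrite expr2; exact: ler_piMr].
have vI : -1 <= v <= 1 by rewrite v1 andbT (le_trans _ v0)// lerN10.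
have aI : acos v \in `[0, pi] by rewrite in_itv/= acos_ge0// acos_lepi.
have e'I : Num.min e pi \in `[0, pi].
  by rewrite in_itv/= le_min (ltW e0) pi_ge0 ge_min lexx orbT.
apply: (@lt_le_trans _ _ (Num.min e pi)); last by rewrite ge_min lexx.
by rewrite -(ltr_cos aI e'I) acosK ?in_itv//; exact: lt_le_trans cv.
Qed.

Lemma L2sq0 : L2sq (fun=> 0 : C) = 0.
Proof.
rewrite -[RHS](mul0r (\int[lebesgue_measure]_(t in @halfline R) 0)).
rewrite -(tame_RintegralZ _ (@tame0 R)) /L2sq; congr (Rintegral _ _ _).
by apply/funext => t; rewrite sqC0 mul0r.
Qed.

Lemma closed_span_Z (I : Type) (A : set I) (F : I -> R -> C) i z :
  A i -> tame_on_halfline (F i) -> closed_span A F (fun t => z * F i t).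
Proof.
move=> Ai tF; split; first by apply: tame_on_halfline_L2; exact: tame_on_halflineZ.
move=> e e0; exists (fun t => z * F i t).
  exists 1%N, (fun=> z), (fun=> i); split=> //.
  by apply/funext => t; rewrite big_ord1.
rewrite /L2dist L2normE (_ : (fun t => _) = (fun=> 0)) ?L2sq0 ?sqrtr0//.
by apply/funext => t; rewrite subrr.
Qed.

(** The projection of the normalized f onto the line of g lies in [E], and its squared distance to
    it is 1 minus the squared cosine. *)
Lemma nearly_parallel_setdist (c : R) (E : set (R -> C)) f g :
  tame_on_halfline f -> tame_on_halfline g -> 0 < L2sq f -> 0 < L2sq g ->
  nearly_parallel c f g -> (forall z, E (fun t => z * g t)) ->
  L2setdist (fun t => ofR (L2norm f)^-1 * f t) E <= Num.sqrt (1 - c).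
Proof.
move=> [f' tf ff] [g' tg gg] f0 g0 hc hE.
pose a := ofR (L2norm f)^-1.
pose z := a * (ofR (L2sq g)^-1 * L2dot f g).
apply: (@le_trans _ _ (L2dist (fun t => a * f t) (fun t => z * g t))).
  apply: ge_inf; last by exists (fun t => z * g t).
  by exists 0 => _ [h _ <-]; rewrite /L2dist L2normE sqrtr_ge0.
rewrite /L2dist L2normE; apply: ler_wsqrtr.
rewrite (@eq_L2sq _ _ (fun t => a * (f' t + - (ofR (L2sq g')^-1 * L2dot f' g') * g' t)));
  last first.
  move=> t t0; rewrite ff// gg// /z (eq_L2sq gg) (eq_L2dot ff gg); ring.
rewrite L2sqZ; last by apply: ctameD => //; exact: ctameZ.
rewrite L2sq_proj//; last by rewrite -(eq_L2sq gg).
rewrite -(eq_L2sq gg) -(eq_L2dot ff gg) -(eq_L2sq ff).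
rewrite /a sqC_ofR L2normE exprVn sqr_sqrtr ?(ltW f0)//.
rewrite mulrBr mulVf ?gt_eqF// lerD2l lerN2.
rewrite (_ : _ * (_ / _) = sqC (L2dot f g) / (L2sq f * L2sq g)); last first.
  by field; rewrite !gt_eqF.
by rewrite ler_pdivlMr// mulr_gt0.
Qed.

End angles_and_distances.

(** * Transfer to the divided differences of a numbering *)

Section gdd_of_numbering.
Context {R : realType}.
Local Notation C := (Cplx R).
Variables (lambda : int -> C) (J : set int) (alpha beta : R).
Hypothesis alpha0 : 0 < alpha.
Hypothesis strip : forall n, J n -> alpha <= ImC (lambda n) <= beta.

Lemma gdd_numbering (A : set int) D nu n : A `<=` J -> is_numbering A D nu ->
  D n -> upper (mkseq (fun j => lambda (nu j)) n.+1) /\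
  forall t, 0 <= t -> gdd n (fun j => lambda (nu j)) t =
    edd (mkseq (fun j => lambda (nu j)) n.+1) t.
Proof.
move=> AJ [dD [fD _ _]] Dn.
have Im0 j : (j <= n)%N -> 0 < ImC (lambda (nu j)).
  move=> /dD/(_ Dn)/fD/AJ/strip/andP[h _]; exact: lt_le_trans h.
split; last by move=> t t0; exact: gddE.
by apply/allP => _ /mapP[j + ->]; rewrite mem_iota ltnS => /Im0.
Qed.

Lemma gdd_tame (A : set int) D nu n : A `<=` J -> is_numbering A D nu ->
  D n -> tame_on_halfline (gdd n (fun j => lambda (nu j))).
Proof.
move=> AJ hD Dn; have [us h] := gdd_numbering AJ hD Dn.
exists (edd (mkseq (fun j => lambda (nu j)) n.+1)); first exact: edd_ctame.
by move=> t t0; apply: h; exact: ltW.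
Qed.

Lemma gdd_L2sq_gt0 (A : set int) D nu n : A `<=` J -> is_numbering A D nu ->
  D n -> 0 < L2sq (gdd n (fun j => lambda (nu j))).
Proof.
move=> AJ hD Dn; have [us h] := gdd_numbering AJ hD Dn.
rewrite (eq_L2sq (fun t t0 => h t (ltW t0))).
by apply: L2sq_edd_gt0 => //; rewrite -size_eq0 size_mkseq.
Qed.

Lemma gdd_nearly_parallel (A : set int) D nu k l : A `<=` J ->
  is_numbering A D nu -> has_step lambda k l -> numbering_prefix D nu l ->
  exists n, D n.+1 /\ nearly_parallel (@near_one R k)
    (gdd n (fun j => lambda (nu j))) (gdd n.+1 (fun j => lambda (nu j))).
Proof.
move=> AJ hD [n [nl np]] pl.
have Dn1 : D n.+1 by have [] := pl _ nl.
have Dn : D n by case: hD => + _; apply; last exact: Dn1.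
have take_mkseq m : (m <= size l)%N ->
    take m (map lambda l) = mkseq (fun j => lambda (nu j)) m.
  move=> ml; apply: (@eq_from_nth _ 0).
    by rewrite size_take_min size_map size_mkseq; apply/minn_idPl.
  rewrite size_take_min size_map => i; rewrite leq_min => /andP[im il].
  rewrite nth_take// nth_mkseq// (nth_map 0)//.
  by have [_ ->] := pl _ il.
exists n; split=> //.
have [_ h] := gdd_numbering AJ hD Dn; have [_ h1] := gdd_numbering AJ hD Dn1.
rewrite /nearly_parallel (eq_L2sq (fun t t0 => h t (ltW t0))).
rewrite (eq_L2sq (fun t t0 => h1 t (ltW t0))).
rewrite (eq_L2dot (fun t t0 => h t (ltW t0)) (fun t t0 => h1 t (ltW t0))).
by move: np; rewrite !take_mkseq// ltnW.
Qed.

End gdd_of_numbering.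

Theorem theorem4 (R : realType) (J : set int) (lambda : int -> Cplx R)
    (alpha beta : R)
    (hmult : finite_multiplicities J lambda)
    (hord : Re_nondecreasing J lambda)
    (halpha : 0 < alpha) (hbeta : alpha <= beta)
    (hstrip : forall n, J n -> alpha <= ImC (lambda n) <= beta)
    (hnrud : ~ relatively_uniformly_discrete J lambda) :
  forall r : R, 0 < r ->
  exists (D : set (Cplx R) -> set nat) (nu : set (Cplx R) -> nat -> int),
    let phi := fun (G : set (Cplx R)) (m : nat) =>
      gdd m (fun j => lambda (nu G j)) in
    [/\ forall G, components J lambda r G ->
          is_numbering (group J lambda G) (D G) (nu G),
        ~ uniformly_minimal
            [set q : set (Cplx R) * nat | components J lambda r q.1 /\ D q.1 q.2]
            (fun q => phi q.1 q.2) &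
        forall epsilon : R, 0 < epsilon ->
          exists (G : set (Cplx R)) (m : nat),
            [/\ components J lambda r G, D G m.+1 &
                L2angle (phi G m) (phi G m.+1) < epsilon]].
Proof.
move=> r r0; have [M hM] := good_numbering halpha hbeta hstrip.
have groupJ (G : set (Cplx R)) : group J lambda G `<=` J by move=> n [].
have /choice[Dnu hDnu] (G : set (Cplx R)) : exists Dnu : set nat * (nat -> int),
    is_numbering (group J lambda G) Dnu.1 Dnu.2 /\
    forall k, has_cluster lambda (group J lambda G) (M k) ->
      exists2 l, has_step lambda k l & numbering_prefix Dnu.1 Dnu.2 l.
  by have [D [nu h]] := hM _ (groupJ G); exists (D, nu).
exists (fun G => (Dnu G).1), (fun G => (Dnu G).2) => phi.
have hnum G := (hDnu G).1.
have key k : exists G n, [/\ components J lambda r G, (Dnu G).1 n.+1 &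
    nearly_parallel (near_one k) (phi G n) (phi G n.+1)].
  have [m hm] := ltr_add_invr r0; rewrite add0r in hm.
  (* Large enough for a cluster of this size to fit in one component and for step k of its
     numbering. *)
  pose m' := maxn m.+1 (M k).
  have mr : m'.+1%:R^-1 <= r.
    apply: le_trans (ltW hm); rewrite lef_pV2 ?posrE ?ltr0n// ler_nat ltnS.
    by rewrite (leq_trans (leqnSn m))// leq_maxl.
  have [|G cG clG] := cluster_in_component _ mr (clusters_of_all_sizes m' hnrud).
    by rewrite leq_max.
  have [l hl pl] := (hDnu G).2 k (has_cluster_le (leq_maxr _ _) clG).
  have [n [Dn np]] := gdd_nearly_parallel halpha hstrip (groupJ G) (hnum G) hl pl.
  by exists G, n.
have DS G n : (Dnu G).1 n.+1 -> (Dnu G).1 n.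
  by move=> h; have [dD _] := hnum G; exact: dD (leqnSn n) h.
have tphi G n : (Dnu G).1 n -> tame_on_halfline (phi G n).
  by move=> h; have := gdd_tame halpha hstrip (groupJ G) (hnum G) h.
have phi0 G n : (Dnu G).1 n -> 0 < L2sq (phi G n).
  by move=> h; have := gdd_L2sq_gt0 halpha hstrip (groupJ G) (hnum G) h.
split; first by move=> G _; exact: hnum.
(* The infimum is at most every e > 0: once 1 / (k + 2) <= e^2, the member [phi G n] supplied by
   [key] is, after normalization, within e of the span of its successor. *)
- rewrite /uniformly_minimal => /lt_geF/negP; apply; apply/lee_addgt0Pr => e e0.
  rewrite add0e.
  have e20 : 0 < e ^+ 2 by rewrite exprn_gt0.
  have [k hk] := ltr_add_invr e20; rewrite add0r in hk.
  have [G [n [cG Dn np]]] := key k.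
  apply: ge_ereal_inf; eexists.
    by exists (G, n) => //; split=> //=; exact: DS.
  rewrite lee_fin /=; apply: (le_trans (nearly_parallel_setdist _ _ _ _ np _)).
  + exact/tphi/DS.
  + exact: tphi.
  + exact/phi0/DS.
  + exact: phi0.
  + move=> z; apply: (@closed_span_Z _ _ _ (fun q => phi q.1 q.2) (G, n.+1)).
      split=> // -[] /eqP; rewrite -[X in X == _]addn1 -[X in _ == X]addn0 eqn_add2l.
      by [].
    exact: tphi.
  + have -> : e = Num.sqrt (e ^+ 2) by rewrite sqrtr_sqr ger0_norm// ltW.
    apply: ler_wsqrtr.
    apply: le_trans (ltW hk); rewrite /near_one opprB addrC subrK.
    by rewrite lef_pV2 ?posrE ?ltr0n// ler_nat.
- move=> e e0.
  have e'0 : 0 < Num.min e pi by rewrite lt_min e0 pi_gt0.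
  (* The threshold is chosen above cos (min e pi), which is less than 1. *)
  have cos1 : 0 < 1 - cos (Num.min e pi).
    rewrite subr_gt0 -cos0 ltr_cos// in_itv/= ?lexx ?pi_ge0//.
    by rewrite (ltW e'0) ge_min lexx orbT.
  have [k hk] := ltr_add_invr cos1; rewrite add0r in hk.
  have [G [n [cG Dn np]]] := key k.
  have hD := DS _ _ Dn.
  exists G, n; split=> //.
  apply: (nearly_parallel_angle _ _ _ _ _ e0 _ np).
  + exact: tphi.
  + exact: tphi.
  + exact: phi0.
  + exact: phi0.
  + by have /andP[? ?] := @near_one_itv R k; rewrite !ltW.
  + rewrite /near_one ltrBrDl -ltrBrDr; apply: le_lt_trans hk.
    by rewrite lef_pV2 ?posrE ?ltr0n// ler_nat.
Qed.
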